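(* For $\alpha \in \mathbb{R}\setminus\mathbb{Q}$ and a function $\varepsilon\colon \mathbb{N}\to(0,\infty)$ set $$\mathcal{A}_\varepsilon^\alpha = \{ n \in \mathbb{N} : \|\alpha n^2\|_{\mathbb{R}/\mathbb{Z}} \le \varepsilon(n)\}.$$ Then the following hold. (A1) For every $\alpha\in\mathbb{R}\setminus\mathbb{Q}$ there exists $\varepsilon_\alpha\colon\mathbb{N}\to(0,\infty)$ with $\varepsilon_\alpha(n)\to 0$ as $n \to \infty$ such that, whenever $\varepsilon(n)\ge\varepsilon_\alpha(n)$ for all $n$, the set $\mathcal{A}_\varepsilon^\alpha$ is an almost basis of order $2$. (A2) There exist uncountably many $\alpha\in\mathbb{R}\setminus\mathbb{Q}$ for each of which there exists $\varepsilon_\alpha\colon\mathbb{N}\to(0,\infty)$ with $\varepsilon_\alpha(n)\to 0$ such that, whenever $\varepsilon(n)\ge\varepsilon_\alpha(n)$ for all $n$, the set $\mathcal{A}_\varepsilon^\alpha$ is a basis of order $2$. (A3) For every $\alpha\in\mathbb{R}\setminus\mathbb{Q}$ there exists $\varepsilon_\alpha\colon\mathbb{N}\to(0,\infty)$ with $\varepsilon_\alpha(n)\to 0$ such that, whenever $\varepsilon(n)\ge\varepsilon_\alpha(n)$ for all $n$, the set $\mathcal{A}_\varepsilon^\alpha$ is a basis of order $3$. (A4) For all $\alpha\in\mathbb{R}\setminus\mathbb{Q}$ outside a set of Lebesgue measure $0$, and for every $\varepsilon\colon\mathbb{N}\to(0,\infty)$ with $\varepsilon(n)\to 0$ as $n\to\infty$,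 the set $\mathcal{A}_\varepsilon^\alpha$ is not a basis of order $2$.
   Context: $\mathbb{N}=\{0,1,2,\dots\}$, $[n]=\{1,\dots,n\}$, and $\|t\|_{\mathbb{R}/\mathbb{Z}}=\min_{n\in\mathbb{Z}}|t-n|$. For $\mathcal{A}\subset\mathbb{N}$, $k\mathcal{A}=\{n_1+\dots+n_k : n_i\in\mathcal{A}\}$. The set $\mathcal{A}$ is a basis of order $k$ if $k\mathcal{A}$ contains all sufficiently large integers; it is an almost basis of order $k$ if $k\mathcal{A}$ has asymptotic density $1$, i.e. $\lim_{n\to\infty}|k\mathcal{A}\cap[n]|/n=1$. *)

(* Defs.v *)
From mathcomp Require Import all_boot all_order all_algebra.
From mathcomp Require Import all_classical all_reals all_analysis.

Set Implicit Arguments.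
Unset Strict Implicit.
Unset Printing Implicit Defensive.

Import Order.TTheory GRing.Theory Num.Theory.
Import numFieldNormedType.Exports.

Local Open Scope classical_set_scope.
Local Open Scope ring_scope.

(* The infimum is attained: see [dist_int_min]. *)
Definition dist_int (R : realType) (t : R) : R :=
  inf [set `|t - n%:~R| | n in [set: int]].

Lemma dist_int_min (R : realType) (t : R) :
  (exists n : int, dist_int t = `|t - n%:~R|) /\
  (forall n : int, dist_int t <= `|t - n%:~R|).
Proof.
set S := [set `|t - n%:~R| | n in [set: int]].
have lbS : has_lbound S by exists 0 => _ [n _ <-].
have leS (n : int) : inf S <= `|t - n%:~R| by apply: ge_inf => //; exists n.
split=> //; set f := Num.floor t.
suff [m Hm] : exists m : int, forall n : int, `|t - m%:~R| <= `|t - n%:~R|.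
  exists m; apply/le_anti; rewrite leS /=; apply: lb_le_inf.
    by exists `|t - m%:~R|, m.
  by move=> _ [n _ <-].
have ft : f%:~R <= t by exact: floor_le.
have tf : t < (f + 1)%:~R by exact: floorD1_gt.
have low (n : int) : (n <= f)%R -> `|t - f%:~R| <= `|t - n%:~R|.
  move=> nf; have nfR : n%:~R <= f%:~R :> R by rewrite ler_int.
  by rewrite !ger0_norm ?subr_ge0 ?lerB// (le_trans nfR).
have high (n : int) : (f + 1 <= n)%R -> `|t - (f + 1)%:~R| <= `|t - n%:~R|.
  move=> fn; have fnR : (f + 1)%:~R <= n%:~R :> R by rewrite ler_int.
  rewrite !(distrC t) !ger0_norm ?subr_ge0 ?lerB// ltW//.
  exact: lt_le_trans fnR.
have split_n (n : int) : (n <= f)%R \/ (f + 1 <= n)%R.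
  by case: (lerP n f) => h; [left|right; rewrite lezD1].
case: (lerP `|t - f%:~R| `|t - (f + 1)%:~R|) => h.
- by exists f => n; case: (split_n n) => [/low//|/high]; exact: le_trans.
- exists (f + 1) => n; case: (split_n n) => [/low|/high//].
  by apply: le_trans; exact: ltW.
Qed.

Definition sq_bohr_set (R : realType) (alpha : R) (eps : nat -> R) : set nat :=
  [set n | dist_int (alpha * n%:R ^+ 2) <= eps n].

Definition sumset (k : nat) (A : set nat) : set nat :=
  [set n | exists a : 'I_k -> nat,
     (forall i, A (a i)) /\ n = (\sum_(i < k) a i)%N].

Definition additive_basis (k : nat) (A : set nat) : Prop :=
  \forall n \near \oo, sumset k A n.

(* [iota 1 n] enumerates {1, ..., n}; the term at n = 0 is immaterial. *)
Definition density_one (R : realType) (A : set nat) : Prop :=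
  (fun n : nat => (count (fun m => m \in A) (iota 1 n))%:R / n%:R : R) @ \oo
    --> (1 : R).

Definition almost_additive_basis (R : realType) (k : nat) (A : set nat) : Prop :=
  density_one R (sumset k A).

(* Main.v *)
(** Van der Corput's inequality bounds the sums of [e(alpha a^2 + mu a + nu)]
    uniformly in [mu] and [nu], and Fejér kernels turn this into the following
    principle: every window of [W] integers contains some [a] making both
    [alpha a^2 + mu a + nu] and [beta a + gamma] nearly integral, unless
    [l beta] is within [C / W] of an integer for some [0 < l <= L].

    Since [alpha (N - a)^2 = alpha a^2 - 2 alpha N a + alpha N^2], the principle with
    [beta = - 2 alpha N] writes [N] as a sum of two elements unless [N] is
    resonant, i.e. [N ||2 l alpha N|| < C] for some [l <= L].  Resonant integers
    have density zero, which gives (A1).  With three summands, fixing the first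
    one to be [a] replaces [beta] by [- 2 alpha (N - a)], and at most one of two
    fixed choices of [a] can be resonant, which gives (A3).  All this is for a
    fixed tolerance; letting the tolerance tend to zero slowly enough gives
    [eps_a].

    For (A4), Lebesgue's density theorem shows that for almost every [alpha] there
    are infinitely many odd [N] with [2 alpha N] extremely close to an odd integer.
    For such [N], [alpha (N - a)^2 - alpha a^2] is close to a half-integer for every
    [a <= N], so [a] and [N - a] cannot both be in the set.

    For (A2), put [a = (N + s) / 2], so that [alpha a^2 - alpha (N - a)^2 = alpha N s].
    If [alpha N] is close to [m / l] in lowest terms, the only obstruction occurs
    for [N] odd and [l] even, and it disappears when
    [|alpha N - m / l| >= (1 - o(1)) / (l N)].  This holds if every other convergent
    of [alpha] has a highly divisible denominator and the partial quotients tend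
    to infinity; there are uncountably many such [alpha] because the construction
    can avoid any given sequence. *)
Require Import Defs.
From mathcomp Require Import all_boot all_order all_algebra.
From mathcomp Require Import all_classical all_reals all_analysis.
From mathcomp Require Import measurable_realfun.
From mathcomp Require Import zify ring lra.
Import Order.TTheory GRing.Theory Num.Theory.
Import numFieldNormedType.Exports.
Local Open Scope classical_set_scope.
Local Open Scope ring_scope.

Set Implicit Arguments.
Unset Strict Implicit.
Unset Printing Implicit Defensive.

(** * Distance to the nearest integer and linear exponential sums *)

Section dist_int.
Variable R : realType.
Implicit Types (x y t : R).

Lemma dist_int_le t (n : int) : dist_int t <= `|t - n%:~R|.
Proof. exact: (dist_int_min t).2. Qed.

Lemma dist_int_witness t : exists n : int, dist_int t = `|t - n%:~R|.
Proof. exact: (dist_int_min t).1. Qed.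

Lemma dist_int_ge0 t : 0 <= dist_int t.
Proof. by have [n ->] := dist_int_witness t. Qed.

Lemma dist_int_le_norm t : dist_int t <= `|t|.
Proof. by have := dist_int_le t 0; rewrite subr0. Qed.

Lemma dist_intD x y : dist_int (x + y) <= dist_int x + dist_int y.
Proof.
have [n ->] := dist_int_witness x; have [m ->] := dist_int_witness y.
apply: le_trans (dist_int_le _ (n + m)) _.
by rewrite intrD (_ : _ - _ = x - n%:~R + (y - m%:~R)) ?ler_normD //; ring.
Qed.

Lemma dist_intN x : dist_int (- x) = dist_int x.
Proof.
have le y : dist_int (- y) <= dist_int y.
  have [n ->] := dist_int_witness y.
  apply: le_trans (dist_int_le _ (- n)) _.
  by rewrite intrN opprK -normrN opprD !opprK.
by apply/le_anti; rewrite le /= -{1}(opprK x) le.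
Qed.

Lemma dist_intB x y : dist_int (x - y) <= dist_int x + dist_int y.
Proof. by rewrite -(dist_intN y) dist_intD. Qed.

Lemma dist_int_addz x (n : int) : dist_int (x + n%:~R) = dist_int x.
Proof.
have le y (m : int) : dist_int (y + m%:~R) <= dist_int y.
  have [k ->] := dist_int_witness y.
  apply: le_trans (dist_int_le _ (k + m)) _.
  by rewrite intrD (_ : _ - _ = y - k%:~R) //; ring.
apply/le_anti; rewrite le /=.
by have := le (x + n%:~R) (- n); rewrite intrN addrK.
Qed.

Lemma dist_int_natM x (n : nat) : dist_int (n%:R * x) <= n%:R * dist_int x.
Proof.
have [k ->] := dist_int_witness x.
apply: le_trans (dist_int_le _ (n%:Z * k)) _.
by rewrite intrM -mulrBr normrM ger0_norm.
Qed.

Lemma dist_int_le_half t : dist_int t <= 2^-1.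
Proof.
have ft : (Num.floor t)%:~R <= t by exact: floor_le.
have tf : t < (Num.floor t + 1)%:~R by exact: floorD1_gt.
have := dist_int_le t (Num.floor t); have := dist_int_le t (Num.floor t + 1).
rewrite intrD in tf *.
rewrite (ler0_norm (x := t - _)) ?(ger0_norm (x := t - _)); lra.
Qed.

Lemma dist_int_gt0 x (k : int) : irrational x -> k != 0 -> 0 < dist_int (k%:~R * x).
Proof.
move=> irrx k0; rewrite lt_neqAle dist_int_ge0 andbT; apply/negP => /eqP.
have [n ->] := dist_int_witness (k%:~R * x) => /esym/eqP.
rewrite normr_eq0 subr_eq0 => /eqP kx.
have k0R : k%:~R != 0 :> R by rewrite intr_eq0.
apply: irrx; exists (n%:~R / k%:~R) => //.
by rewrite fmorph_div /= !ratr_int -kx mulrC mulKf.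
Qed.

(** On [0, 1] the mean value theorem gives slope at least [cos 1]; beyond 1 the sine increases, and
    the factor 1/2 absorbs x <= pi / 2 < 2. *)
Lemma sin_le_cos1 x : 0 <= x <= pi / 2 -> cos 1 * x / 2 <= sin x.
Proof.
have c1 := @cos1_gt0 R; have pi2 := @pihalf_lt2 R; have pi1 := @pihalf_ge1 R.
have le1 y : 0 <= y <= 1 -> cos 1 * y <= sin y.
  move=> /andP[y0 y1]; have [->|yn0] := eqVneq y 0; first by rewrite mulr0 sin0.
  have ypos : 0 < y by lra.
  have [z /[!in_itv]/= /andP[z0 zy]] : exists2 z, z \in `]0, y[%R &
      sin y - sin 0 = cos z * (y - 0).
    apply: MVT => //.
    by apply/continuous_subspaceT => z; exact: continuous_sin.
  rewrite sin0 !subr0 => ->; rewrite ler_pM2r //.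
  by rewrite leNgt ltr_cos ?in_itv /= -?leNgt; lra.
move=> /andP[x0 xpi]; have [x1|x1] := leP x 1.
  apply: le_trans (le1 x _); last lra.
  have := mulr_ge0 (ltW c1) x0; lra.
have s1 : sin 1 <= sin x.
  apply/ltW; rewrite ltr_sin //; rewrite in_itv /=; lra.
have := le1 1 ltac:(lra); rewrite mulr1 => h.
apply: le_trans s1; apply: le_trans h; rewrite -mulrA ger_pMr //; lra.
Qed.

Lemma sin_pi_int (n : int) : sin (pi * n%:~R) = 0 :> R.
Proof.
have H k : sin (pi *+ k) = 0 :> R.
  by elim: k => [|k]; rewrite ?mulr0n ?sin0 // mulrSr sinDpi => ->; rewrite oppr0.
by case: n => k; rewrite ?NegzE ?intrN ?mulrN ?sinN -pmulrn mulr_natr H ?oppr0.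
Qed.

(** Since |sin(pi x)| has period 1, x may be replaced by its offset d from the nearest integer; pi
    >= 2 absorbs the 1/2 of [sin_le_cos1]. *)
Lemma sin_pi_dist_int x : cos 1 * dist_int x <= `|sin (pi * x)|.
Proof.
have [n dE] := dist_int_witness x.
have sinE : `|sin (pi * (x - n%:~R))| = `|sin (pi * x)|.
  rewrite mulrBr sinB.
  by rewrite sin_pi_int mulr0 subr0 normrM (sin0cos1 (sin_pi_int n)) mulr1.
rewrite -sinE dE; have := dist_int_le_half x; rewrite dE.
set d := x - n%:~R => dhalf.
have pi2 := @pi_ge2 R; have c1 := @cos1_gt0 R.
have -> : `|sin (pi * d)| = `|sin (pi * `|d|)|.
  by case: (ger0P d) => // _; rewrite mulrN sinN normrN.
have pd : 0 <= pi * `|d| <= pi / 2.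
  by rewrite mulr_ge0 //= ?pi_ge0 // ler_pM2l ?pi_gt0.
apply: le_trans (ler_norm _); apply: le_trans (sin_le_cos1 pd).
by rewrite -!mulrA ler_pM2l // mulrCA ler_peMr //; clear sinE dE; lra.
Qed.
End dist_int.

Section trig_sums.
Variable R : realType.
Implicit Types (x t xi c : R).

(** Multiplication by 2 sin(pi xi) makes the sum telescope. Keeping the sine as a factor avoids a
    division, and the free phase [c] also covers sine sums. *)
Lemma sum_cos_linear W xi c :
  `|\sum_(a < W) cos (2 * pi * (xi * a%:R + c))| * `|sin (pi * xi)| <= 1.
Proof.
pose g (a : nat) := sin (2 * pi * (xi * a%:R + c) - pi * xi).
have E : 2 * sin (pi * xi) * \sum_(a < W) cos (2 * pi * (xi * a%:R + c)) = g W - g 0%N.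
  rewrite -(big_mkord xpredT (fun a : nat => cos (2 * pi * (xi * a%:R + c)))).
  rewrite mulr_sumr -(telescope_sumr g) //; apply: eq_bigr => a _.
  rewrite /g (_ : _ - pi * xi = 2 * pi * (xi * a%:R + c) + pi * xi); last first.
    by rewrite -natr1; ring.
  rewrite sinD sinB; ring.
rewrite mulrC -normrM; set S := _ * _.
have -> : S = (g W - g 0%N) / 2 by rewrite -E /S; field.
rewrite normrM [`|2^-1|]ger0_norm // ler_pdivrMr // mul1r.
apply: le_trans (ler_normB _ _) _.
rewrite /g; move: (sin_max (2 * pi * (xi * W%:R + c) - pi * xi)).
move: (sin_max (2 * pi * (xi * 0%:R + c) - pi * xi)); lra.
Qed.

(** This is |sum_p e^(i x_p)|^2 expanded, the real substitute for complex exponentials. *)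
Lemma sum_cos_sub (I : finType) (x : I -> R) :
  \sum_p \sum_q cos (x p - x q) = (\sum_p cos (x p)) ^+ 2 + (\sum_p sin (x p)) ^+ 2.
Proof.
rewrite !expr2 !big_distrlr /= -big_split /=; apply: eq_bigr => p _.
by rewrite -big_split /=; apply: eq_bigr => q _; rewrite cosB.
Qed.
End trig_sums.

(** * Quadratic exponential sums *)

Section real_helpers.
Variable R : realType.

Lemma exists_nat_gt (x : R) : exists n : nat, x < n%:R.
Proof.
exists (Num.bound `|x|); apply: le_lt_trans (ler_norm x) _.
exact: archi_boundP.
Qed.

Lemma finite_lower_bound (f : nat -> R) (n : nat) :
  (forall i, (i < n)%N -> 0 < f i) ->
  exists eta : R, 0 < eta /\ forall i, (i < n)%N -> eta <= f i.
Proof.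
elim: n => [|n IH] f0; first by exists 1; split.
have [|eta [eta0 etaP]] := IH; first by move=> i /ltnW; exact: f0.
exists (Num.min eta (f n)); split; first by rewrite lt_min eta0 f0.
move=> i; rewrite ltnS leq_eqVlt => /predU1P[->|/etaP etai].
  by rewrite ge_min lexx orbT.
by rewrite ge_min etai.
Qed.

Lemma finite_eventually (P : nat -> nat -> Prop) (n : nat) :
  (forall i, (i < n)%N -> exists w, forall W, (w <= W)%N -> P i W) ->
  exists w, forall i, (i < n)%N -> forall W, (w <= W)%N -> P i W.
Proof.
elim: n => [|n IH] ex; first by exists 0%N.
have [|w wP] := IH; first by move=> i /ltnW; exact: ex.
have [w' w'P] := ex n (ltnSn n); exists (maxn w w') => i.
rewrite ltnS leq_eqVlt => /predU1P[->|/wP wi] W; rewrite geq_max => /andP[h h'].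
  exact: w'P.
exact: wi.
Qed.

(** Cauchy-Schwarz against the constant sequence, from y_a y_b <= (y_a^2 + y_b^2) / 2. *)
Lemma sqr_sum_le (W : nat) (y : nat -> R) :
  (\sum_(a < W) y a) ^+ 2 <= W%:R * \sum_(a < W) y a ^+ 2.
Proof.
rewrite expr2 big_distrlr /=.
apply: (@le_trans _ _ (\sum_(a < W) \sum_(b < W) (y a ^+ 2 / 2 + y b ^+ 2 / 2))).
  apply: ler_sum => a _; apply: ler_sum => b _.
  have := sqr_ge0 (y a - y b); rewrite sqrrB; lra.
rewrite (eq_bigr (fun a : 'I_W => W%:R * (y a ^+ 2 / 2) + \sum_(b < W) (y b ^+ 2 / 2))).
  rewrite big_split /= -mulr_sumr sumr_const card_ord.
  rewrite -[X in _ + X <= _]mulr_natl -mulrDr -big_split /=.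
  by under eq_bigr do rewrite -splitr.
by move=> a _; rewrite big_split /= sumr_const card_ord -[X in X + _]mulr_natl.
Qed.

(** By telescoping, each shift by one changes only two boundary terms. *)
Lemma sum_shift_le (u : nat -> R) (W h : nat) : (forall a, `|u a| <= 1) ->
  `|\sum_(a < W) u a - \sum_(a < W) u (a + h)%N| <= 2 * h%:R.
Proof.
move=> u1; elim: h => [|h IH].
  by under [X in _ - X]eq_bigr do rewrite addn0; rewrite subrr normr0 mulr0.
have step : `|\sum_(a < W) u (a + h)%N - \sum_(a < W) u (a + h.+1)%N| <= 2.
  rewrite -sumrB -normrN -sumrN.
  rewrite (eq_bigr (fun a : 'I_W => u (a.+1 + h)%N - u (a + h)%N)); last first.
    by move=> a _; rewrite opprB addnS addSn.
  rewrite -(big_mkord xpredT (fun a => u (a.+1 + h)%N - u (a + h)%N)).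
  rewrite (telescope_sumr (fun a => u (a + h)%N)) //.
  by apply: le_trans (ler_normB _ _) _; move: (u1 (W + h)%N) (u1 (0 + h)%N); lra.
apply: le_trans (ler_distD (\sum_(a < W) u (a + h)%N) _ _) _.
rewrite -[h.+1%:R]natr1 mulrDr mulr1; exact: lerD.
Qed.
End real_helpers.

Section weyl.
Variable R : realType.
Implicit Types (x : nat -> R) (alpha mu nu eps delta : R).

(** The sum S is averaged over the shifts h < H, at a total cost of 2 H^2. Cauchy-Schwarz in a and
    expansion of the square give H diagonal pairs worth W each and at most H^2 others worth at most
    K. The last step is (T + E)^2 <= 2 T^2 + 2 E^2. *)
Lemma van_der_corput x (W H : nat) (K : R) : (0 < H)%N -> 0 <= K ->
  (forall h k : 'I_H, h != k ->
     `|\sum_(a < W) cos (2 * pi * (x (a + h)%N - x (a + k)%N))| <= K) ->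
  (H%:R * \sum_(a < W) cos (2 * pi * x a)) ^+ 2 <=
    2 * (W%:R * (H%:R * W%:R + H%:R ^+ 2 * K)) + 8 * H%:R ^+ 4.
Proof.
move=> H0 K0 HK; set S := \sum_(a < W) _.
pose T := \sum_(a < W) \sum_(h < H) cos (2 * pi * x (a + h)%N).
have ST : `|H%:R * S - T| <= 2 * H%:R ^+ 2.
  rewrite /T exchange_big /= -[H in H%:R * S]card_ord mulr_natl -sumr_const -sumrB.
  apply: le_trans (ler_norm_sum _ _ _) _.
  apply: (@le_trans _ _ (\sum_(h < H) (2 * H%:R : R))).
    apply: ler_sum => h _.
    apply: le_trans (sum_shift_le (u := fun a => cos (2 * pi * x a)) _ _ _) _.
      by move=> a; exact: cos_max.
    by rewrite ler_pM2l // ler_nat ltnW.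
  by rewrite sumr_const card_ord -[leLHS]mulr_natr expr2 mulrA.
have T2 : T ^+ 2 <= W%:R * (H%:R * W%:R + H%:R ^+ 2 * K).
  apply: le_trans (sqr_sum_le _ (fun a => \sum_(h < H) cos (2 * pi * x (a + h)%N))) _.
  rewrite ler_wpM2l //.
  apply: (@le_trans _ _ (\sum_(a < W) \sum_(h < H) \sum_(k < H)
      cos (2 * pi * (x (a + h)%N - x (a + k)%N)))).
    apply: ler_sum => a _.
    under [leRHS]eq_bigr do under eq_bigr do rewrite mulrBr.
    by rewrite sum_cos_sub lerDl sqr_ge0.
  rewrite exchange_big /=.
  have -> : H%:R * W%:R + H%:R ^+ 2 * K = \sum_(h < H) (W%:R + H%:R * K).
    by rewrite sumr_const card_ord -[RHS]mulr_natl mulrDr expr2 mulrA.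
  apply: ler_sum => h _; rewrite exchange_big /= (bigD1 h) //=; apply: lerD.
    under eq_bigr do rewrite subrr mulr0 cos0.
    by rewrite sumr_const card_ord.
  apply: (@le_trans _ _ (\sum_(k < H | k != h) K)).
    by apply: ler_sum => k kh; apply: le_trans (ler_norm _) _; apply: HK; rewrite eq_sym.
  rewrite sumr_const -[leLHS]mulr_natl ler_wpM2r // ler_nat.
  by apply: leq_trans (max_card _) _; rewrite card_ord.
have -> : H%:R * S = T + (H%:R * S - T) by rewrite addrC subrK.
set E := H%:R * S - T in ST *.
have E2 : E ^+ 2 <= 4 * H%:R ^+ 4.
  rewrite -real_normK ?num_real //.
  apply: (@le_trans _ _ ((2 * H%:R ^+ 2) ^+ 2)); first by rewrite lerXn2r ?nnegrE.
  by rewrite [leLHS](_ : _ = 4 * H%:R ^+ 4) //; ring.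
move: T2 E2; set X := _ * (_ + _); set Y := _ ^+ 4 => T2 E2.
have : 0 <= T ^+ 2 - 2 * (T * E) + E ^+ 2 by have := sqr_ge0 (T - E); rewrite sqrrB mulr_natl.
have -> : (T + E) ^+ 2 = T ^+ 2 + 2 * (T * E) + E ^+ 2 by ring.
lra.
Qed.

(** Differencing turns the quadratic phase into a linear one of frequency 2 (h - k) alpha. There
    [mu] and [nu] affect only the constant phase, whence the uniformity. *)
Lemma weyl_quadratic alpha eps : irrational alpha -> 0 < eps ->
  exists W0 : nat, forall (W : nat) mu nu, (W0 <= W)%N ->
    `|\sum_(a < W) cos (2 * pi * (alpha * a%:R ^+ 2 + mu * a%:R + nu))| <= eps * W%:R.
Proof.
move=> irr eps0; have e2 : 0 < eps ^+ 2 by rewrite exprn_gt0.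
(* [H] makes the diagonal term small, [eta] keeps the finitely many frequencies 2 d alpha away from
   the integers, and [W1], [W2] handle the two remaining terms. Each of the three gets a third of
   (eps W)^2. *)
have [H HP] := exists_nat_gt (6 / eps ^+ 2).
have Hpos : 0 < H%:R :> R by apply: lt_trans HP; rewrite divr_gt0.
have [eta [eta0 etaP]] : exists eta : R, 0 < eta /\
    forall d, (d < H)%N -> (0 < d)%N -> eta <= dist_int ((2 * d)%N%:R * alpha).
  have [|eta [eta0 etaP]] := @finite_lower_bound R (fun d => dist_int ((2 * d.+1)%N%:R * alpha)) H.
    by move=> d _; apply: (dist_int_gt0 (k := (2 * d.+1)%N)).
  by exists eta; split=> // -[|d] dH // _; apply: etaP; exact: ltnW.
have c1 := @cos1_gt0 R.
pose K := (cos 1 * eta)^-1; have K0 : 0 < K by rewrite invr_gt0 mulr_gt0.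
have [W1 W1P] := exists_nat_gt (6 * K / eps ^+ 2).
have [W2 W2P] := exists_nat_gt (24 * H%:R ^+ 2 / eps ^+ 2).
exists (maxn W1 W2).+1 => W mu nu; rewrite -[(maxn _ _ < W)%N]/(_ <= _)%N gtn_max => /andP[WW1 WW2].
set S := \sum_(a < W) _.
have Wpos : 1 <= W%:R :> R by rewrite ler1n (leq_ltn_trans _ WW1).
have main : (H%:R * S) ^+ 2 <= 2 * (W%:R * (H%:R * W%:R + H%:R ^+ 2 * K)) + 8 * H%:R ^+ 4.
  apply: (van_der_corput (x := fun a => alpha * a%:R ^+ 2 + mu * a%:R + nu)) => //.
  - by rewrite -(ltr_nat R).
  - exact: ltW.
  move=> h k hk.
  have := sum_cos_linear W (2 * (h%:R - k%:R) * alpha)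
     (alpha * h%:R ^+ 2 + mu * h%:R - (alpha * k%:R ^+ 2 + mu * k%:R)).
  set A := `|\sum_(a < W) _|; set B := `|\sum_(a < W) _|.
  have -> : B = A.
    congr `|_|; apply: eq_bigr => a _; congr (cos (_ * _)); rewrite !natrD; ring.
  have : cos 1 * eta <= `|sin (pi * (2 * (h%:R - k%:R) * alpha))|.
    apply: le_trans (sin_pi_dist_int _); rewrite ler_pM2l //.
    have : exists d, [/\ (d < H)%N, (0 < d)%N & h%:R - k%:R = d%:R :> R \/ h%:R - k%:R = - d%:R :> R].
      have [lt|gt|/val_inj/eqP] := ltngtP h k; last by rewrite (negbTE hk).
        exists (k - h)%N; split; [|by rewrite subn_gt0|right].
          exact: leq_ltn_trans (leq_subr _ _) (ltn_ord k).
        by rewrite natrB 1?ltnW // opprB.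
      exists (h - k)%N; split; [|by rewrite subn_gt0|left].
        exact: leq_ltn_trans (leq_subr _ _) (ltn_ord h).
      by rewrite natrB 1?ltnW.
    case=> d [dH d0 dE]; apply: le_trans (etaP d dH d0) _.
    by case: dE => ->; rewrite ?(mulrN, mulNr) ?dist_intN natrM.
  set s := `|sin _| => sK AK; rewrite /K -[leRHS]mul1r ler_pdivlMr ?mulr_gt0 //.
  by apply: le_trans AK; rewrite ler_wpM2l ?normr_ge0.
rewrite exprMn in main.
have : S ^+ 2 <= (eps * W%:R) ^+ 2.
  have h1 : 6 <= H%:R * eps ^+ 2 by rewrite -ler_pdivrMr // ltW.
  have h2 : 6 * K <= W%:R * eps ^+ 2.
    rewrite -ler_pdivrMr //; apply/ltW; apply: lt_trans W1P _; by rewrite ltr_nat.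
  have h3 : 24 * H%:R ^+ 2 <= W%:R * eps ^+ 2.
    rewrite -ler_pdivrMr //; apply/ltW; apply: lt_trans W2P _; by rewrite ltr_nat.
  rewrite -(ler_pM2l (x := H%:R ^+ 2)) ?exprn_gt0 //; apply: le_trans main _.
  rewrite exprMn; move: h1 h2 h3 Hpos Wpos K0 e2.
  move: (eps ^+ 2) (W%:R : R) (H%:R : R) => e w h h1 h2 h3 h0 w1 k0 e0.
  have a1 : h * w ^+ 2 * 6 <= h * w ^+ 2 * (h * e).
    by rewrite ler_wpM2l // mulr_ge0 ?sqr_ge0 // ltW.
  have w0 : 0 <= w by lra.
  have a2 : w * h ^+ 2 * (6 * K) <= w * h ^+ 2 * (w * e).
    by rewrite ler_wpM2l // mulr_ge0 ?sqr_ge0 // ltW.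
  have a3 : h ^+ 2 * (24 * h ^+ 2) <= h ^+ 2 * (w * e) by rewrite ler_wpM2l ?sqr_ge0.
  have a4 : h ^+ 2 * (w * e) * 1 <= h ^+ 2 * (w * e) * w.
    by rewrite ler_wpM2l // !mulr_ge0 ?sqr_ge0 // ltW.
  have -> : 2 * (w * (h * w + h ^+ 2 * K)) + 8 * h ^+ 4 =
     (h * w ^+ 2 * 6) / 3 + (w * h ^+ 2 * (6 * K)) / 3 + (h ^+ 2 * (24 * h ^+ 2)) / 3 by field.
  have -> : h ^+ 2 * (e * w ^+ 2) = h * w ^+ 2 * (h * e) / 3 + w * h ^+ 2 * (w * e) / 3 +
     h ^+ 2 * (w * e) * w / 3 by field.
  lra.
rewrite -[X in X <= _]real_normK ?num_real // ler_pXn2r ?nnegrE // mulr_ge0 ?ltW //; lra.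
Qed.
End weyl.

(** * From exponential sums to simultaneous approximation *)

Section fejer.
Variable R : realType.
Implicit Types (s t alpha mu nu beta gamma eps delta : R).

(** This is |sum_(j < J) e(j t)|^2, or J times the usual Fejér kernel, kept expanded so that its sum
    over sample points splits into exponential sums. *)
Definition fejer_kernel (J : nat) t : R :=
  \sum_(i < J) \sum_(j < J) cos (2 * pi * (i%:R * t) - 2 * pi * (j%:R * t)).

Lemma fejer_kernel_ge0 J t : 0 <= fejer_kernel J t.
Proof.
rewrite /fejer_kernel (sum_cos_sub (fun i : 'I_J => 2 * pi * (i%:R * t))).
by rewrite addr_ge0 ?sqr_ge0.
Qed.

Lemma fejer_kernel_le J delta t : 0 < delta -> delta <= dist_int t ->
  fejer_kernel J t <= 2 / (cos 1 * delta) ^+ 2.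
Proof.
move=> d0 dt; have c1 := @cos1_gt0 R.
rewrite /fejer_kernel (sum_cos_sub (fun i : 'I_J => 2 * pi * (i%:R * t))).
have cd : 0 < cos 1 * delta by rewrite mulr_gt0.
have bound S : `|S| * `|sin (pi * t)| <= 1 -> S ^+ 2 <= (cos 1 * delta) ^- 2.
  move=> h; rewrite -exprVn -real_normK ?num_real // lerXn2r ?nnegrE ?invr_ge0 ?(ltW cd) //.
  rewrite -[leRHS]mul1r ler_pdivlMr //; apply: le_trans h.
  rewrite ler_wpM2l ?normr_ge0 //; apply: le_trans (sin_pi_dist_int t).
  by rewrite ler_pM2l.
(* The phase -1/4 turns the cosine sum into the sine sum. *)
have := bound _ (sum_cos_linear J t 0); have := bound _ (sum_cos_linear J t (- (1 / 4))).
under eq_bigr => i _.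
  rewrite (_ : 2 * pi * _ = 2 * pi * (i%:R * t) - pi / 2); last by field.
  rewrite cosBpihalf; over.
under [X in _ -> X ^+ 2 <= _ -> _]eq_bigr do rewrite addr0 [t * _]mulrC.
lra.
Qed.

(** Both sides are |sum_(i, j < J) e(i s + j t)|^2, because the double sum factors. *)
Lemma fejer_kernelM J s t : fejer_kernel J s * fejer_kernel J t =
  \sum_(p : 'I_J * 'I_J) \sum_(q : 'I_J * 'I_J)
    cos (2 * pi * ((p.1%:R - q.1%:R) * s + (p.2%:R - q.2%:R) * t)).
Proof.
pose a i : R := 2 * pi * (i%:R * s); pose b i : R := 2 * pi * (i%:R * t).
have -> : \sum_(p : 'I_J * 'I_J) \sum_(q : 'I_J * 'I_J)
    cos (2 * pi * ((p.1%:R - q.1%:R) * s + (p.2%:R - q.2%:R) * t)) =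
  \sum_(p : 'I_J * 'I_J) \sum_(q : 'I_J * 'I_J) cos (a p.1 + b p.2 - (a q.1 + b q.2)).
  by apply: eq_bigr => p _; apply: eq_bigr => q _; congr cos; rewrite /a /b; ring.
rewrite (sum_cos_sub (fun p : 'I_J * 'I_J => a p.1 + b p.2)).
rewrite /fejer_kernel (sum_cos_sub (fun i : 'I_J => a i)) (sum_cos_sub (fun i : 'I_J => b i)).
rewrite -!(pair_bigA _ (fun i j : 'I_J => _ (a i + b j))) /=.
set ca := \sum_(p < J) cos (a p); set sa := \sum_(p < J) sin (a p).
set cb := \sum_(p < J) cos (b p); set sb := \sum_(p < J) sin (b p).
have -> : \sum_(i < J) \sum_(j < J) cos (a i + b j) = ca * cb - sa * sb.
  rewrite !big_distrlr -sumrB /=; apply: eq_bigr => i _.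
  by rewrite -sumrB; apply: eq_bigr => j _; rewrite cosD.
have -> : \sum_(i < J) \sum_(j < J) sin (a i + b j) = sa * cb + ca * sb.
  rewrite !big_distrlr -big_split /=; apply: eq_bigr => i _.
  by rewrite -big_split; apply: eq_bigr => j _; rewrite sinD.
ring.
Qed.

(* If no [a < W] had both [f a] and [g a] close to integers, the product of the
   Fejér kernels at [f a] and [g a] would be at most a constant times their sum;
   but the average over [a] of the product is about [J ^ 2] and that of the sum
   is about [2 J]. *)
Lemma small_exp_sums_dist_int delta : 0 < delta ->
  exists (J : nat) (eps : R), 0 < eps /\
    forall (W : nat) (f g : nat -> R), (0 < W)%N ->
    (forall i j k l : 'I_J, (i, j) != (k, l) ->
       `|\sum_(a < W) cos (2 * pi * ((i%:R - k%:R) * f a + (j%:R - l%:R) * g a))|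
         <= eps * W%:R) ->
    exists2 a, (a < W)%N & dist_int (f a) < delta /\ dist_int (g a) < delta.
Proof.
move=> d0; have c1 := @cos1_gt0 R.
pose B : R := 2 / (cos 1 * delta) ^+ 2.
have B0 : 0 < B by rewrite divr_gt0 // exprn_gt0 // mulr_gt0.
have [J JB] := exists_nat_gt (4 * B).
have J0 : 0 < J%:R :> R by apply: lt_trans JB; rewrite mulr_gt0.
(* The at most J^4 off-diagonal terms of the product then contribute at most J^2 W / 4, and the J^2
   of each kernel at most W / 4. The comparison becomes (3/4) J^2 <= 2 B J + B / 2, which fails for
   J > 4 B. *)
pose eps : R := (4 * J%:R ^+ 2)^-1.
have eps0 : 0 < eps by rewrite invr_gt0 mulr_gt0 // exprn_gt0.
exists J, eps; split=> // W f g W0 small; apply: contrapT => none.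
have WR : 0 < W%:R :> R by rewrite ltr0n.
have le a : (a < W)%N -> fejer_kernel J (f a) * fejer_kernel J (g a) <=
    B * (fejer_kernel J (f a) + fejer_kernel J (g a)).
  move=> aW; have Ff := fejer_kernel_ge0 J (f a); have Fg := fejer_kernel_ge0 J (g a).
  have [fa|fa] := leP delta (dist_int (f a)).
    have := ler_wpM2r Fg (fejer_kernel_le J d0 fa); rewrite -/B.
    have := mulr_ge0 (ltW B0) Ff; rewrite mulrDr; lra.
  have [ga|ga] := leP delta (dist_int (g a)).
    have := ler_wpM2l Ff (fejer_kernel_le J d0 ga); rewrite -/B.
    have := mulr_ge0 (ltW B0) Fg; rewrite mulrDr; lra.
  by case: none; exists a.
have J_gt0 : (0 < J)%N by rewrite -(ltr_nat R).
pose o := Ordinal J_gt0.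
have upf : \sum_(a < W) fejer_kernel J (f a) <= J%:R * (W%:R + J%:R * (eps * W%:R)).
  have -> (Z : R) : J%:R * Z = \sum_(i < J) Z by rewrite sumr_const card_ord mulr_natl.
  rewrite /fejer_kernel exchange_big /=.
  apply: ler_sum => i _; rewrite exchange_big /= (bigD1 i) //=; apply: lerD.
    by under eq_bigr do rewrite subrr cos0; rewrite sumr_const card_ord.
  apply: (@le_trans _ _ (\sum_(k < J | k != i) eps * W%:R)).
    apply: ler_sum => k ki; apply: le_trans (ler_norm _) _.
    have := small i o k o; rewrite xpair_eqE negb_and eq_sym ki => /(_ isT).
    by congr (`|_| <= _); apply: eq_bigr => a _; rewrite subrr mul0r addr0 mulrBl mulrBr.
  rewrite sumr_const -[leLHS]mulr_natl ler_wpM2r ?mulr_ge0 ?(ltW eps0) ?(ltW WR) // ler_nat.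
  by apply: leq_trans (max_card _) _; rewrite card_ord.
have upg : \sum_(a < W) fejer_kernel J (g a) <= J%:R * (W%:R + J%:R * (eps * W%:R)).
  have -> (Z : R) : J%:R * Z = \sum_(i < J) Z by rewrite sumr_const card_ord mulr_natl.
  rewrite /fejer_kernel exchange_big /=.
  apply: ler_sum => i _; rewrite exchange_big /= (bigD1 i) //=; apply: lerD.
    by under eq_bigr do rewrite subrr cos0; rewrite sumr_const card_ord.
  apply: (@le_trans _ _ (\sum_(k < J | k != i) eps * W%:R)).
    apply: ler_sum => k ki; apply: le_trans (ler_norm _) _.
    have := small o i o k; rewrite xpair_eqE negb_and orbC eq_sym ki => /(_ isT).
    by congr (`|_| <= _); apply: eq_bigr => a _; rewrite subrr mul0r add0r mulrBl mulrBr.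
  rewrite sumr_const -[leLHS]mulr_natl ler_wpM2r ?mulr_ge0 ?(ltW eps0) ?(ltW WR) // ler_nat.
  by apply: leq_trans (max_card _) _; rewrite card_ord.
have low : J%:R ^+ 2 * (W%:R - J%:R ^+ 2 * (eps * W%:R) : R) <=
    \sum_(a < W) (fejer_kernel J (f a) * fejer_kernel J (g a)).
  under [leRHS]eq_bigr do rewrite fejer_kernelM.
  have -> (Z : R) : J%:R ^+ 2 * Z = \sum_(p : 'I_J * 'I_J) Z.
    by rewrite sumr_const card_prod !card_ord -[RHS]mulr_natl natrM expr2.
  rewrite exchange_big /=.
  apply: ler_sum => p _; rewrite exchange_big /= (bigD1 p) //=; apply: lerD.
    by under eq_bigr do rewrite !subrr !mul0r addr0 mulr0 cos0; rewrite sumr_const card_ord.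
  apply: (@le_trans _ _ (\sum_(q : 'I_J * 'I_J | q != p) - (eps * W%:R))).
    rewrite sumrN lerN2 sumr_const -[leLHS]mulr_natl ler_wpM2r ?mulr_ge0 ?(ltW eps0) ?(ltW WR) //.
    rewrite -natrX ler_nat; apply: leq_trans (max_card _) _.
    by rewrite card_prod card_ord.
  apply: ler_sum => q qp; rewrite lerNl; apply: le_trans (ler_norm _) _; rewrite normrN.
  by apply: small; rewrite -!surjective_pairing eq_sym.
have : J%:R ^+ 2 * (W%:R - J%:R ^+ 2 * (eps * W%:R)) <=
    B * (J%:R * (W%:R + J%:R * (eps * W%:R)) + J%:R * (W%:R + J%:R * (eps * W%:R))).
  apply: le_trans low _.
  apply: (@le_trans _ _ (\sum_(a < W) B * (fejer_kernel J (f a) + fejer_kernel J (g a)))).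
    by apply: ler_sum => a _; exact: le.
  by rewrite -mulr_sumr big_split /= ler_pM2l // lerD.
have -> : J%:R ^+ 2 * (W%:R - J%:R ^+ 2 * (eps * W%:R)) = J%:R ^+ 2 * W%:R * (3 / 4).
  by rewrite /eps; field; rewrite gt_eqF.
have -> : B * (J%:R * (W%:R + J%:R * (eps * W%:R)) + J%:R * (W%:R + J%:R * (eps * W%:R))) =
   2 * B * J%:R * W%:R + B * W%:R / 2.
  by rewrite /eps; field; rewrite gt_eqF.
rewrite leNgt => /negP; apply.
have -> : J%:R ^+ 2 * W%:R * (3 / 4) = W%:R * (J%:R ^+ 2 * (3 / 4)) :> R by ring.
have -> : 2 * B * J%:R * W%:R + B * W%:R / 2 = W%:R * (2 * B * J%:R + B / 2) by ring.
rewrite ltr_pM2l //.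
have J1 : 1 <= J%:R :> R by rewrite ler1n.
have h1 : 4 * B * J%:R < J%:R * J%:R by rewrite ltr_pM2r.
have h2 : B * 1 <= B * J%:R by rewrite ler_pM2l.
rewrite expr2; lra.
Qed.

Lemma irrational_mul_int alpha (k : int) : irrational alpha -> k != 0 ->
  irrational (k%:~R * alpha).
Proof.
move=> irr k0 [q _ qE]; apply: irr; exists (q / k%:~R) => //.
by rewrite fmorph_div /= ratr_int qE mulrC mulKf // intr_eq0.
Qed.

(** In the exponential sums of the Fejér argument, indices with i != k leave a quadratic phase with
    coefficient (i - k) alpha, small by Weyl whatever the linear part, hence whatever [beta]. For i
    = k the phase is linear with frequency a nonzero multiple of [beta] below J, and nonresonance up
    to [L] = J bounds it. *)
Theorem quadratic_linear_dist_int alpha delta : irrational alpha -> 0 < delta ->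
  exists (L : nat) (C : R) (W0 : nat), 0 < C /\
    forall (W : nat) mu nu beta gamma, (W0 <= W)%N ->
    (forall l, (0 < l <= L)%N -> C <= W%:R * dist_int (l%:R * beta)) ->
    exists2 a, (a < W)%N &
      dist_int (alpha * a%:R ^+ 2 + mu * a%:R + nu) < delta /\
      dist_int (beta * a%:R + gamma) < delta.
Proof.
move=> irr d0; have [J [eps [eps0 main]]] := small_exp_sums_dist_int d0.
have c1 := @cos1_gt0 R.
have [W1 W1P] : exists w, forall d, (d < J)%N -> forall W, (w <= W)%N ->
    (0 < d)%N -> forall mu nu,
    `|\sum_(a < W) cos (2 * pi * (d%:R * alpha * a%:R ^+ 2 + mu * a%:R + nu))| <= eps * W%:R.
  apply: finite_eventually => -[|d] dJ; first by exists 0%N.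
  have [] := weyl_quadratic (alpha := d.+1%:R * alpha) _ eps0.
    exact: (irrational_mul_int (k := d.+1)).
  by move=> w wP; exists w => W wW _ mu nu; exact: wP.
exists J, (cos 1 * eps)^-1, (maxn 1 W1); split; first by rewrite invr_gt0 mulr_gt0.
move=> W mu nu beta gamma; rewrite geq_max => /andP[W0 WW1] nonres.
apply: main => // i j k l ijkl.
have diff (p q : 'I_J) : p != q -> exists2 d, (0 < d < J)%N &
    p%:R - q%:R = d%:R :> R \/ p%:R - q%:R = - d%:R :> R.
  move=> pq; have [lt|gt|/val_inj/eqP] := ltngtP p q; last by rewrite (negbTE pq).
    exists (q - p)%N; last by right; rewrite natrB 1?ltnW // opprB.
    by rewrite subn_gt0 lt (leq_ltn_trans (leq_subr _ _)).
  exists (p - q)%N; last by left; rewrite natrB 1?ltnW.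
  by rewrite subn_gt0 gt (leq_ltn_trans (leq_subr _ _)).
have [ik|ik] := eqVneq i k; last first.
  have [d /andP[dpos dJ] dE] := diff _ _ ik.
  case: dE => ->.
    have := W1P d dJ W WW1 dpos (d%:R * mu + (j%:R - l%:R) * beta)
      (d%:R * nu + (j%:R - l%:R) * gamma).
    by congr (`|_| <= _); apply: eq_bigr => a _; congr cos; ring.
  have := W1P d dJ W WW1 dpos (d%:R * mu - (j%:R - l%:R) * beta)
      (d%:R * nu - (j%:R - l%:R) * gamma).
  by congr (`|_| <= _); apply: eq_bigr => a _; rewrite -cosN; congr cos; ring.
move: ijkl; rewrite ik xpair_eqE eqxx /= => jl.
have [d /andP[dpos dJ] dE] := diff _ _ jl.
have Cd := nonres d; rewrite dpos (ltnW dJ) in Cd; have {}Cd := Cd isT.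
have := sum_cos_linear W (d%:R * beta) (d%:R * gamma).
set A := `|_|; have -> : `|\sum_(a < W) cos (2 * pi * ((k%:R - k%:R) *
     (alpha * a%:R ^+ 2 + mu * a%:R + nu) + (j%:R - l%:R) * (beta * a%:R + gamma)))| = A.
  congr `|_|; apply: eq_bigr => a _; rewrite subrr mul0r add0r.
  by case: dE => ->; [|rewrite -cosN]; congr cos; ring.
have A0 : 0 <= A by exact: normr_ge0.
move: (sin_pi_dist_int (d%:R * beta)) Cd (dist_int_ge0 (d%:R * beta)).
move: (dist_int _) `|sin _| => D s cD; rewrite -[X in X <= _]mul1r ler_pdivrMr ?mulr_gt0 // => WD D0 As.
have WR : 0 < W%:R :> R by rewrite ltr0n.
have : A * (cos 1 * D) <= 1 by apply: le_trans As; rewrite ler_wpM2l.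
move=> h; have : A * 1 <= A * (W%:R * D * (cos 1 * eps)) by rewrite ler_wpM2l.
have : (A * (cos 1 * D)) * (W%:R * eps) <= 1 * (W%:R * eps).
  by rewrite ler_wpM2r // mulr_ge0 // ltW.
rewrite (_ : A * (W%:R * D * (cos 1 * eps)) = A * (cos 1 * D) * (W%:R * eps)); last ring.
lra.
Qed.

(** The linear form alpha a serves as a dummy: irrationality keeps it nonresonant for large
    windows. *)
Corollary quadratic_dist_int alpha delta : irrational alpha -> 0 < delta ->
  exists W0 : nat, forall (W : nat) mu nu, (W0 <= W)%N ->
    exists2 a, (a < W)%N & dist_int (alpha * a%:R ^+ 2 + mu * a%:R + nu) < delta.
Proof.
move=> irr d0; have [L [C [W0 [C0 main]]]] := quadratic_linear_dist_int irr d0.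
have [eta [eta0 etaP]] := @finite_lower_bound R (fun l => dist_int (l.+1%:R * alpha)) L
   (fun l _ => dist_int_gt0 (k := l.+1) irr isT).
have [W1 W1P] := exists_nat_gt (C / eta).
exists (maxn W0 W1) => W mu nu; rewrite geq_max => /andP[WW0 WW1].
have [|a aW [aP _]] := main W mu nu alpha 0 WW0; last by exists a.
move=> [|l] // /andP[_ lL]; apply: (@le_trans _ _ (W%:R * eta)); last first.
  by rewrite ler_wpM2l // etaP.
by rewrite -ler_pdivrMr // ltW // (lt_le_trans W1P) // ler_nat.
Qed.
End fejer.

(** * Two and three summands *)

Section diagonal.

(** [kappa N] is the largest k <= N with Y k <= N. The cumulative sums [Y] dominate the thresholds
    [w], and both constraints on k weaken as N grows, which gives monotonicity. *)
Lemma slow_diagonal (P : nat -> nat -> Prop) :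
  (forall k, exists w, forall N, (w <= N)%N -> P k N) ->
  exists kappa : nat -> nat,
    [/\ {homo kappa : m n / (m <= n)%N},
        forall k, exists w, forall N, (w <= N)%N -> (k <= kappa N)%N &
        exists w, forall N, (w <= N)%N -> P (kappa N) N].
Proof.
move=> /choice[w wP]; pose Y k := (\sum_(j < k.+1) w j)%N.
pose kappa N := (\max_(k < N.+1 | (Y k <= N)%N) k)%N.
have kappa_ge k N : (k <= N)%N -> (Y k <= N)%N -> (k <= kappa N)%N.
  move=> kN YN.
  by have := @leq_bigmax_cond _ (fun i : 'I_N.+1 => (Y i <= N)%N) val (Ordinal (kN : (k < N.+1)%N)) YN.
exists kappa; split.
- move=> m n mn; apply/bigmax_leqP => k Yk; apply: kappa_ge.
    by apply: leq_trans mn; rewrite -ltnS.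
  exact: leq_trans mn.
- by move=> k; exists (maxn k (Y k)) => N; rewrite geq_max => /andP[]; exact: kappa_ge.
- exists (Y 0%N) => N YN.
  have [|i Yi kE] := @eq_bigmax_cond _ (fun i : 'I_N.+1 => (Y i <= N)%N) val.
    by apply/card_gt0P; exists ord0.
  rewrite (kE : kappa N = i); apply: wP; apply: leq_trans Yi; rewrite /Y big_ord_recr /=; exact: leq_addl.
Qed.
End diagonal.

Section two_three_summands.
Variable R : realType.
Implicit Types (alpha delta : R) (A : set nat).

Lemma sumset2 A a b : A a -> A b -> sumset 2 A (a + b)%N.
Proof.
move=> Aa Ab; exists (fun i : 'I_2 => if val i == 0%N then a else b).
by split; [move=> i; case: ifP | rewrite !big_ord_recl big_ord0 /= addn0].
Qed.

Lemma sumset3 A a b c : A a -> A b -> A c -> sumset 3 A (a + b + c)%N.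
Proof.
move=> Aa Ab Ac.
exists (fun i : 'I_3 => if val i == 0%N then a else if val i == 1%N then b else c).
split; first by move=> i; case: ifP => // _; case: ifP.
by rewrite !big_ord_recl big_ord0 /= addn0 addnA.
Qed.

Lemma sumset_mono k A B n : (forall m, (m <= n)%N -> A m -> B m) ->
  sumset k A n -> sumset k B n.
Proof.
move=> AB [a [Aa nE]]; exists a; split=> // i; apply: AB (Aa i).
by rewrite nE (bigD1 i) //= leq_addr.
Qed.

Lemma inv_slow_eps (kappa : nat -> nat) : {homo kappa : m n / (m <= n)%N} ->
  (forall k, exists w, forall N, (w <= N)%N -> (k <= kappa N)%N) ->
  [/\ forall n, 0 < (kappa n).+1%:R^-1 :> R,
      (fun n => (kappa n).+1%:R^-1 : R) @ \oo --> (0 : R) &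
      forall m n, (m <= n)%N -> (kappa n).+1%:R^-1 <= (kappa m).+1%:R^-1 :> R].
Proof.
move=> mono unb; split=> [n||m n mn]; first by rewrite invr_gt0.
  apply/cvgrPdist_le => e e0; have [k kP] := exists_nat_gt e^-1.
  have [w wP] := unb k; exists w => // N /= /wP kN.
  rewrite sub0r normrN ger0_norm ?invr_ge0 // invf_ple ?posrE //.
  by apply: le_trans (ltW kP) _; rewrite ler_nat ltnW.
by rewrite lef_pV2 ?posrE // ler_nat ltnS mono.
Qed.

(** The tolerance [eps_a] is nonincreasing and summands of N are at most N, so the fixed tolerance
    valid at N is granted to every summand. *)
Lemma uniform_basis k alpha :
  (forall delta, 0 < delta -> exists N0, forall N, (N0 <= N)%N ->
     sumset k (sq_bohr_set alpha (fun=> delta)) N) ->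
  exists eps_a : nat -> R,
    [/\ forall n, 0 < eps_a n, eps_a @ \oo --> (0 : R) &
        forall eps : nat -> R, (forall n, 0 < eps n) ->
          (forall n, eps_a n <= eps n) -> additive_basis k (sq_bohr_set alpha eps)].
Proof.
move=> unif.
have [|kappa [mono unb [w wP]]] := @slow_diagonal
  (fun k' N => sumset k (sq_bohr_set alpha (fun=> k'.+1%:R^-1)) N).
  by move=> j; apply: unif; rewrite invr_gt0.
have [e0 ecvg emono] := inv_slow_eps mono unb.
exists (fun n => (kappa n).+1%:R^-1); split=> // eps _ le_eps.
exists w => // N /= /wP; apply: sumset_mono => m mN; rewrite /sq_bohr_set /= => h.
by apply: le_trans (le_eps m); apply: le_trans h _; exact: emono.
Qed.

(** * Sets of density zero *)

Definition density_zero (p : pred nat) : Prop :=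
  forall eta : R, 0 < eta -> exists X0, forall X, (X0 <= X)%N ->
    (count p (iota 1 X))%:R <= eta * X%:R.

Lemma density_zero_sub (p q : pred nat) : subpred p q -> density_zero q -> density_zero p.
Proof.
move=> pq dq eta /dq[X0 X0P]; exists X0 => X /X0P; apply: le_trans.
by rewrite ler_nat sub_count.
Qed.

Lemma density_zeroU (p q : pred nat) :
  density_zero p -> density_zero q -> density_zero (predU p q).
Proof.
move=> dp dq eta eta0; have e2 : 0 < eta / 2 by rewrite divr_gt0.
have [X0 X0P] := dp _ e2; have [X1 X1P] := dq _ e2.
exists (maxn X0 X1) => X; rewrite geq_max => /andP[/X0P pX /X1P qX].
apply: (@le_trans _ _ ((count p (iota 1 X) + count q (iota 1 X))%N%:R)).
  by rewrite ler_nat -count_predUI leq_addr.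
by rewrite natrD; lra.
Qed.

Lemma density_zero_bounded (n : nat) : density_zero (fun m => m < n)%N.
Proof.
move=> eta eta0; have [X0 X0P] := exists_nat_gt (n%:R / eta).
exists X0 => X XX0; apply: (@le_trans _ _ (n%:R)).
  rewrite ler_nat -[leqRHS](size_iota 0) -size_filter.
  apply: uniq_leq_size; first by rewrite filter_uniq // iota_uniq.
  by move=> m; rewrite mem_filter !mem_iota => /andP[].
rewrite mulrC -ler_pdivrMr //; apply: le_trans (ltW X0P) _; by rewrite ler_nat.
Qed.

Lemma density_zero_exists (q : nat -> pred nat) (L : nat) :
  (forall l, (0 < l <= L)%N -> density_zero (q l)) ->
  density_zero (fun n => has (q^~ n) (iota 1 L)).
Proof.
elim: L => [|L IH] qd.
  by apply: density_zero_sub (@density_zero_bounded 0).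
apply: (@density_zero_sub _ (predU (fun n => has (q^~ n) (iota 1 L)) (q L.+1))).
  have -> : iota 1 L.+1 = iota 1 L ++ [:: L.+1] by rewrite -[X in iota _ X = _]addn1 iotaD add1n.
  by move=> n; rewrite has_cat /= orbF.
apply: density_zeroU; last by apply: qd; rewrite leqnn.
by apply: IH => l /andP[l0 lL]; apply: qd; rewrite l0 leqW.
Qed.

(** The diagonal runs over the length X of the counting interval: every m <= X is tested with the
    single tolerance attached to X, which is at most [eps_a] at each summand of m. *)
Lemma uniform_almost_basis k alpha :
  (forall delta, 0 < delta ->
     density_zero (fun N => N \notin sumset k (sq_bohr_set alpha (fun=> delta)))) ->
  exists eps_a : nat -> R,
    [/\ forall n, 0 < eps_a n, eps_a @ \oo --> (0 : R) &
        forall eps : nat -> R, (forall n, 0 < eps n) ->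
          (forall n, eps_a n <= eps n) -> almost_additive_basis R k (sq_bohr_set alpha eps)].
Proof.
move=> unif.
have [|kappa [mono unb [w wP]]] := @slow_diagonal (fun j X =>
  (count (fun N => N \notin sumset k (sq_bohr_set alpha (fun=> j.+1%:R^-1))) (iota 1 X))%:R
    <= j.+1%:R^-1 * X%:R :> R).
  by move=> j; apply: unif; rewrite invr_gt0.
have [e0 ecvg emono] := inv_slow_eps mono unb.
exists (fun n => (kappa n).+1%:R^-1); split=> // eps _ le_eps.
apply/cvgrPdist_le => e epos; move/cvgrPdist_le : ecvg => /(_ e epos)[w' _ w'P].
exists (maxn 1 (maxn w w')) => // X /=; rewrite !geq_max => /andP[X0 /andP[/wP wX /w'P]] /=.
rewrite sub0r normrN ger0_norm ?invr_ge0 // => eX.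
set S := sumset k _; set c := count _ _.
have XR : 0 < X%:R :> R by rewrite ltr0n.
have cE : X%:R = c%:R + (count (fun m => m \notin S) (iota 1 X))%:R :> R.
  by rewrite -natrD -[in LHS](size_iota 1 X) -(count_predC (fun m => m \in S)).
have -> : 1 - c%:R / X%:R = (count (fun m => m \notin S) (iota 1 X))%:R / X%:R :> R.
  by rewrite -[X in X - _](divff (lt0r_neq0 XR)) -mulrBl {1}cE addrAC subrr add0r.
rewrite ger0_norm ?divr_ge0 // ler_pdivrMr //; apply: le_trans (ler_wpM2r (ltW XR) eX).
apply: le_trans wX; rewrite ler_nat -!size_filter.
apply: uniq_leq_size; first by rewrite filter_uniq // iota_uniq.
move=> m; rewrite !mem_filter mem_iota => /andP[mS /andP[m0 mX]]; rewrite m0 mX !andbT.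
apply: contra mS; rewrite !inE; apply: sumset_mono => n nm; rewrite /sq_bohr_set /= => h.
apply: le_trans (le_eps n); apply: le_trans h _; apply: emono.
by apply: leq_trans nm _; rewrite -ltnS -add1n.
Qed.

Lemma ltn_pred_sub (m n K : nat) : (m < n < m + K)%N -> ((n - m).-1 < K)%N.
Proof. lia. Qed.

(** Past N, each block of K consecutive integers holds at most one element; the successor accounts
    for the incomplete last block. *)
Lemma count_spaced (p : pred nat) (N K : nat) : (0 < K)%N ->
  (forall m n, (N <= m)%N -> (m < n < m + K)%N -> p m -> p n -> False) ->
  forall X, (count p (iota 1 X) <= N + (X %/ K).+1)%N.
Proof.
move=> K0 sp; have block m : (N <= m)%N -> (count p (iota m K) <= 1)%N.
  move=> Nm; rewrite -size_filter.
  have srt : sorted ltn (seq.filter p (iota m K)).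
    by apply: sorted_filter; [exact: ltn_trans | exact: iota_ltn_sorted].
  have sub x : x \in seq.filter p (iota m K) -> [/\ p x, (m <= x)%N & (x < m + K)%N].
    by rewrite mem_filter mem_iota => /andP[px /andP[]].
  case: (seq.filter p (iota m K)) srt sub => [|x [|y s]] //= /andP[xy _] sub.
  have [px mx _] : [/\ p x, (m <= x)%N & (x < m + K)%N] by apply: sub; rewrite inE eqxx.
  have [py _ ym] : [/\ p y, (m <= y)%N & (y < m + K)%N].
    by apply: sub; rewrite !inE eqxx orbT.
  by case: (sp x y _ _ px py); [lia | lia].
have blocks m j : (N <= m)%N -> (count p (iota m (j * K)) <= j)%N.
  elim: j m => [|j IH] m Nm //; rewrite mulSn iotaD count_cat -[j.+1]add1n leq_add ?block //.
  by apply: IH; lia.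
move=> X; apply: (@leq_trans (count p (iota 1 (N + (X %/ K).+1 * K)))).
  have XE : (X <= N + (X %/ K).+1 * K)%N by have := ltn_ceil X K0; lia.
  by rewrite -(subnKC XE) iotaD count_cat leq_addr.
rewrite iotaD count_cat leq_add ?blocks //.
by apply: leq_trans (count_size _ _) _; rewrite size_iota.
Qed.

(** If m < n are both resonant and large, then (n - m) xi is very close to an integer, which rules
    out bounded gaps n - m. The gaps thus eventually reach any K, and the density is at most 1 / K <
    eta / 2. *)
Lemma density_zero_resonant (xi C : R) : irrational xi -> 0 < C ->
  density_zero (fun N => N%:R * dist_int (xi * N%:R) < C).
Proof.
move=> irr C0 eta eta0; have [K KP] := exists_nat_gt (2 / eta).
have K0 : (0 < K)%N by rewrite -(ltr_nat R); apply: lt_trans KP; rewrite divr_gt0.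
have [c [c0 cP]] := @finite_lower_bound R (fun j => dist_int (j.+1%:R * xi)) K
   (fun j _ => dist_int_gt0 (k := j.+1) irr isT).
have [N NP] := exists_nat_gt (2 * C / c).
have N0 : 0 < N%:R :> R by apply: lt_trans NP; rewrite divr_gt0 // mulr_gt0.
have small m : (N <= m)%N -> m%:R * dist_int (xi * m%:R) < C -> dist_int (xi * m%:R) < c / 2.
  move=> Nm h; have Nm' : N%:R <= m%:R :> R by rewrite ler_nat.
  have m0 : 0 < m%:R :> R by apply: lt_le_trans Nm'.
  rewrite -(ltr_pM2l m0); apply: lt_trans h _; move: NP; rewrite ltr_pdivrMr // => NP.
  have := ler_wpM2r (ltW c0) Nm'; lra.
have cnt := @count_spaced (fun N => N%:R * dist_int (xi * N%:R) < C) N K K0.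
have [X0 X0P] := exists_nat_gt (2 * N.+1%:R / eta).
exists X0 => X XX0; apply: (@le_trans _ _ ((N + (X %/ K).+1)%N%:R)).
  rewrite ler_nat; apply: cnt => m n Nm mnK pm pn; have /andP[mn _] := mnK.
  have dm := small m Nm pm; have dn := small n (leq_trans Nm (ltnW mn)) pn.
  have := cP _ (ltn_pred_sub mnK); rewrite prednK ?subn_gt0 // natrB ?(ltnW mn) //.
  have := dist_intB (xi * n%:R) (xi * m%:R).
  rewrite (_ : xi * n%:R - xi * m%:R = (n%:R - m%:R) * xi); last by ring.
  lra.
rewrite addnS -addSn natrD.
have h1 : N.+1%:R <= eta * X%:R / 2.
  rewrite ler_pdivlMr // mulrC [eta * _]mulrC -ler_pdivrMr //; apply: le_trans (ltW X0P) _.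
  by rewrite ler_nat.
have h2 : (X %/ K)%:R <= eta * X%:R / 2.
  have : (X %/ K)%:R * K%:R <= X%:R :> R by rewrite -natrM ler_nat leq_trunc_div.
  move: KP; rewrite ltr_pdivrMr // => KP h.
  have Q0 : 0 <= (X %/ K)%:R :> R by [].
  have := ler_wpM2l Q0 (ltW KP).
  have := ler_wpM2r (ltW eta0) h; lra.
lra.
Qed.

(** * Representations by two and three summands *)

Lemma quadratic_shift_dist_int alpha (m b : nat) :
  dist_int (alpha * (m%:R - b%:R) ^+ 2) <=
  dist_int (alpha * b%:R ^+ 2) + dist_int (- (2 * alpha * m%:R) * b%:R + alpha * m%:R ^+ 2).
Proof.
by apply: le_trans (dist_intD _ _); rewrite (_ : alpha * b%:R ^+ 2 + _ = alpha * (m%:R - b%:R) ^+ 2) //; ring.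
Qed.

Lemma nonresonant_order2 alpha delta : irrational alpha -> 0 < delta ->
  exists (L : nat) (C : R) (W0 : nat), 0 < C /\ forall N, (W0 <= N)%N ->
    (forall l, (0 < l <= L)%N -> C <= N%:R * dist_int ((- 2 * l%:R) * alpha * N%:R)) ->
    sumset 2 (sq_bohr_set alpha (fun=> delta)) N.
Proof.
move=> irr d0; have d2 : 0 < delta / 2 by rewrite divr_gt0.
have [L [C [W0 [C0 main]]]] := quadratic_linear_dist_int irr d2.
exists L, C, W0; split=> // N NW0 nonres.
have [|a aN [da db]] := main N 0 0 (- (2 * alpha * N%:R)) (alpha * N%:R ^+ 2) NW0.
  by move=> l /nonres; congr (_ <= _ * dist_int _); ring.
rewrite mul0r !addr0 in da.
rewrite -(subnKC (ltnW aN)); apply: sumset2; rewrite /sq_bohr_set /=; first lra.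
by rewrite natrB ?(ltnW aN) //; apply: le_trans (quadratic_shift_dist_int _ _ _) _; lra.
Qed.

Theorem almost_basis_order2 alpha delta : irrational alpha -> 0 < delta ->
  density_zero (fun N => N \notin sumset 2 (sq_bohr_set alpha (fun=> delta))).
Proof.
move=> irr d0; have [L [C [W0 [C0 main]]]] := nonresonant_order2 irr d0.
apply: (@density_zero_sub _ (predU (fun N => N < W0)%N
   (fun N => has (fun l => N%:R * dist_int ((- 2 * l%:R) * alpha * N%:R) < C) (iota 1 L)))).
  move=> N; rewrite inE; apply: contraR; rewrite negb_or -leqNgt => /andP[NW0 /hasPn nonres].
  apply/asboolP; apply: main => // l lL; have := nonres l.
  by rewrite mem_iota add1n ltnS lL => /(_ isT); rewrite -leNgt.
apply: density_zeroU; first exact: density_zero_bounded.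
apply: density_zero_exists => l /andP[l0 _]; apply: density_zero_resonant => //.
rewrite (_ : - 2 * l%:R = (- (2 * l%:Z))%:~R); last by rewrite intrN intrM mulNr.
by apply: irrational_mul_int => //; lia.
Qed.

Theorem basis_order3 alpha delta : irrational alpha -> 0 < delta ->
  exists N0, forall N, (N0 <= N)%N -> sumset 3 (sq_bohr_set alpha (fun=> delta)) N.
Proof.
move=> irr d0; have d2 : 0 < delta / 2 by rewrite divr_gt0.
have [L [C [W0 [C0 main]]]] := quadratic_linear_dist_int irr d2.
have [W1 W1P] := quadratic_dist_int irr d2.
have [a1 a1W da1] := W1P W1 0 0 (leqnn _); rewrite mul0r !addr0 in da1.
(* The same estimate applied to (W1 + t)^2 gives a second fixed summand, distinct from the first
   because a1 < W1 <= a2. *)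
have [t tW dt] := W1P W1 (2 * alpha * W1%:R) (alpha * W1%:R ^+ 2) (leqnn _).
pose a2 := (W1 + t)%N.
have da2 : dist_int (alpha * a2%:R ^+ 2) < delta / 2.
  by rewrite (_ : _ * _ = alpha * t%:R ^+ 2 + 2 * alpha * W1%:R * t%:R + alpha * W1%:R ^+ 2) // natrD; ring.
have a12 : (a1 < a2)%N by rewrite /a2; lia.
(* Were both choices resonant, with multipliers l1 and l2, eliminating N would put 2 l1 l2 (a2 - a1)
   alpha within 2 L C / W of an integer. The bound [c] excludes this for large W. *)
have [c [c0 cP]] := @finite_lower_bound R (fun j => dist_int (j.+1%:R * alpha))
   (2 * L * L * (a2 - a1))%N (fun j _ => dist_int_gt0 (k := j.+1) irr isT).
have [W2 W2P] := exists_nat_gt (2 * L%:R * C / c).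
exists (a2 + maxn W0 W2.+1)%N => N NN.
pose W := (N - a2)%N.
have a2N : (a2 <= N)%N by apply: leq_trans NN; exact: leq_addr.
have /andP[WW0 W2W] : (W0 <= W)%N && (W2 < W)%N.
  by rewrite -geq_max leq_subRL.
have WW2 : 2 * L%:R * C < W%:R * c.
  by rewrite -ltr_pdivrMr //; apply: lt_trans W2P _; rewrite ltr_nat.
have finish a : (a <= a2)%N -> dist_int (alpha * a%:R ^+ 2) < delta / 2 ->
    (forall l, (0 < l <= L)%N -> C <= W%:R * dist_int (l%:R * - (2 * alpha * (N - a)%:R))) ->
    sumset 3 (sq_bohr_set alpha (fun=> delta)) N.
  move=> aa2 da nonres.
  have [b bW [db dc]] := main W 0 0 _ (alpha * (N - a)%:R ^+ 2) WW0 nonres.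
  rewrite mul0r !addr0 in db.
  have bNa : (b <= N - a)%N by apply: leq_trans (ltnW bW) _; exact: leq_sub2l.
  have -> : N = (a + b + (N - a - b))%N by rewrite -addnA !subnKC // (leq_trans aa2).
  have le2 x : x < delta / 2 -> x <= delta by clear -d0; lra.
  apply: sumset3; rewrite /sq_bohr_set /=; [exact: le2 | exact: le2 |].
  rewrite natrB //.
  by apply: le_trans (quadratic_shift_dist_int _ _ _) _; lra.
have [nonres1|] := pselect (forall l, (0 < l <= L)%N ->
    C <= W%:R * dist_int (l%:R * - (2 * alpha * (N - a1)%:R))).
  by apply: (finish a1) => //; exact: ltnW.
move=> /existsNP[l1 /not_implyP[/andP[l10 l1L] /negP]]; rewrite -ltNge => res1.
apply: (finish a2) => // l2 /andP[l20 l2L]; rewrite leNgt; apply/negP => res2.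
have le1 := dist_int_natM (l1%:R * - (2 * alpha * (N - a1)%:R)) l2.
have le2 := dist_int_natM (l2%:R * - (2 * alpha * (N - a2)%:R)) l1.
have := cP (2 * l1 * l2 * (a2 - a1)).-1.
have pos : (0 < 2 * l1 * l2 * (a2 - a1))%N by rewrite !muln_gt0 l10 l20 subn_gt0.
rewrite prednK // => /(_ _)/wrap[].
  by rewrite leq_mul2r; apply/orP; right; rewrite leq_mul // leq_mul.
apply/negP; rewrite -ltNge.
have -> : (2 * l1 * l2 * (a2 - a1))%:R * alpha =
   l1%:R * (l2%:R * - (2 * alpha * (N - a2)%:R)) - l2%:R * (l1%:R * - (2 * alpha * (N - a1)%:R)).
  by rewrite !natrM !natrB ?(ltnW a12) // ?(leq_trans (ltnW a12)) //; ring.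
apply: le_lt_trans (dist_intB _ _) _.
have l1R : l1%:R <= L%:R :> R by rewrite ler_nat.
have l2R : l2%:R <= L%:R :> R by rewrite ler_nat.
have WR : 0 < W%:R :> R by rewrite ltr0n (leq_trans _ W2W).
have := ler_wpM2r (dist_int_ge0 (l1%:R * - (2 * alpha * (N - a1)%:R))) l2R.
have := ler_wpM2r (dist_int_ge0 (l2%:R * - (2 * alpha * (N - a2)%:R))) l1R.
move: le1 le2 res1 res2.
move: (dist_int (l1%:R * - _)) (dist_int (l2%:R * - _)) => D1 D2.
move: (dist_int (l2%:R * _)) (dist_int (l1%:R * _)) => E1 E2 le1 le2 res1 res2 m1 m2.
rewrite -(ltr_pM2l WR); apply: le_lt_trans WW2.
have : L%:R * (W%:R * D1) <= L%:R * C by rewrite ler_wpM2l // ltW.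
have : L%:R * (W%:R * D2) <= L%:R * C by rewrite ler_wpM2l // ltW.
have : W%:R * E1 <= W%:R * (L%:R * D1) by rewrite ler_pM2l //; lra.
have : W%:R * E2 <= W%:R * (L%:R * D2) by rewrite ler_pM2l //; lra.
rewrite mulrDr !(mulrCA L%:R); lra.
Qed.
End two_three_summands.

(** * Failure of order two almost everywhere *)

Section odd_approximation.
Variable R : realType.
Implicit Types (x y alpha c : R).

(** Pigeonhole: the fractional parts of j y for 0 <= j <= Q are Q + 1 points in Q intervals of
    length 1 / Q. *)
Lemma dirichlet_approx y (Q : nat) : (0 < Q)%N ->
  exists (q : nat) (p : int), [/\ (0 < q)%N, (q <= Q)%N & `|q%:R * y - p%:~R| < Q%:R^-1].
Proof.
move=> Q0; have QR : 0 < Q%:R :> R by rewrite ltr0n.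
pose t (j : nat) : R := j%:R * y - (Num.floor (j%:R * y))%:~R.
have tP j : 0 <= t j < 1.
  rewrite /t subr_ge0 ltrBlDl; have /andP[-> ] := floor_itv (j%:R * y).
  by rewrite intrD.
have /choice[k kP] (j : nat) : exists k : 'I_Q, k%:R <= Q%:R * t j < k%:R + 1.
  have /andP[t0 t1] := tP j; have Qt0 : 0 <= Q%:R * t j by rewrite mulr_ge0 ?ler0n.
  have /andP[f1 f2] := floor_itv (Q%:R * t j).
  have f0 : 0 <= Num.floor (Q%:R * t j) by rewrite floor_ge0.
  have fE : Num.floor (Q%:R * t j) = `|Num.floor (Q%:R * t j)|%N by rewrite gez0_abs.
  have kQ : (`|Num.floor (Q%:R * t j)| < Q)%N.
    rewrite -(ltr_nat R); apply: (@le_lt_trans _ _ (Q%:R * t j)).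
      by move: f1; rewrite [in X in X -> _]fE -pmulrn.
    by rewrite -[ltRHS]mulr1 ltr_pM2l.
  by exists (Ordinal kQ); rewrite /=; move: f1 f2; rewrite intrD fE -pmulrn => -> ->.
have /injectivePn[i [j ij kij]] : ~~ injectiveb (fun i : 'I_Q.+1 => k i).
  by apply/injectiveP => /leq_card; rewrite !card_ord ltnn.
wlog {ij} ij : i j kij / (i < j)%N.
  move=> H; have [/H|ji|/val_inj/eqP] := ltngtP i j; first exact.
    by apply: (H j i).
  by rewrite (negbTE ij).
exists (j - i)%N, (Num.floor (j%:R * y) - Num.floor (i%:R * y)).
split; first by rewrite subn_gt0.
  by apply: leq_trans (leq_subr _ _) _; rewrite -ltnS.
rewrite natrB 1?ltnW // intrB.
rewrite (_ : _ - _ = t j - t i); last by rewrite /t; ring.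
have /andP[i1 i2] := kP i; have /andP[j1 j2] := kP j; rewrite -kij in j1 j2.
rewrite -(ltr_pM2l QR) divff ?gt_eqF //.
rewrite -{1}(ger0_norm (ltW QR)) -normrM ltr_norml mulrBr; lra.
Qed.

(* [q] is large because [|q y - p|] is bounded below for bounded [q], and
   dividing [p / q] by its gcd only improves [|q y - p|]. *)
Lemma reduced_approx y (n : nat) : irrational y ->
  exists (q : nat) (p u v : int), [/\ (0 < q)%N, (n <= q)%N, u * p + v * q = 1 &
    `|y - p%:~R / q%:R| <= q%:R ^- 2].
Proof.
move=> irr.
have [c [c0 cP]] := @finite_lower_bound R (fun j => dist_int (j.+1%:R * y)) n
   (fun j _ => dist_int_gt0 (k := j.+1) irr isT).
have [Q QP] := exists_nat_gt c^-1.
have Q0 : (0 < Q)%N by rewrite -(ltr_nat R); apply: lt_trans QP; rewrite invr_gt0.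
have QR : 0 < Q%:R :> R by rewrite ltr0n.
have [q [p [q0 qQ qp]]] := dirichlet_approx y Q0.
have [u [v uv]] := Bezoutz p q%:Z.
have gd : gcdz p q%:Z = (gcdn `|p| q)%:Z by rewrite /gcdz.
have g0 : (0 < gcdn `|p| q)%N by rewrite gcdn_gt0 q0 orbT.
set g := gcdn `|p| q in gd g0.
have [p' pE] : exists p' : int, p = p' * g%:Z.
  by apply/dvdzP; rewrite -gd dvdz_gcdl.
have [q' qE] : exists q' : nat, q = (q' * g)%N by apply/dvdnP; exact: dvdn_gcdr.
have gR : 1 <= g%:R :> R by rewrite ler1n.
have q'0 : (0 < q')%N by move: q0; rewrite qE muln_gt0 => /andP[].
have q'R : 0 < q'%:R :> R by rewrite ltr0n.
have h : `|q'%:R * y - p'%:~R| < Q%:R^-1.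
  apply: le_lt_trans qp; rewrite pE qE natrM intrM -pmulrn mulrAC -mulrBl normrM.
  by rewrite (ger0_norm (_ : 0 <= g%:R)) // ler_peMr.
exists q', p', u, v; split=> //.
- rewrite leqNgt; apply/negP => q'n.
  have := cP q'.-1; rewrite prednK // => /(_ (ltnW q'n)) cq.
  have := dist_int_le (q'%:R * y) p'.
  have : Q%:R^-1 < c by rewrite invf_plt ?posrE.
  move: cq h; lra.
- have gz : g%:Z != 0 by rewrite eqz_nat -lt0n.
  by apply: (mulIf gz); rewrite mul1r mulrDl -!mulrA -pE -PoszM -qE uv.
- rewrite (_ : y - _ = (q'%:R * y - p'%:~R) / q'%:R); last first.
    by field; rewrite gt_eqF.
  rewrite normrM normfV (ger0_norm (ltW q'R)) ler_pdivrMr // expr2 invfM mulfVK ?gt_eqF //.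
  apply: le_trans (ltW h) _; rewrite lef_pV2 ?posrE // ler_nat.
  by apply: leq_trans qQ; rewrite qE leq_pmulr.
Qed.

Lemma int_parity (a : int) : exists i : int, a = 2 * i \/ a = 2 * i + 1.
Proof.
exists (a %/ 2)%Z; have := divz_eq a 2; have := modz_ge0 a (isT : 2 != 0 :> int).
have := ltz_pmod a (isT : 0 < 2 :> int); lia.
Qed.

(** Modulo 2, (p, q) and (p', q') are distinct nonzero vectors. There are only three such vectors,
    so one of the two is (1, 1) or their sum is. *)
Lemma unimodular_odd_sum (p q p' q' : int) : p * q' - p' * q = 1 ->
  exists i j : int, [\/ p = 2 * i + 1 /\ q = 2 * j + 1,
    p' = 2 * i + 1 /\ q' = 2 * j + 1 | p + p' = 2 * i + 1 /\ q + q' = 2 * j + 1].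
Proof.
have [a pE] := int_parity p; have [b qE] := int_parity q.
have [c p'E] := int_parity p'; have [d q'E] := int_parity q' => det.
have [pq|npq] := pselect (p = 2 * a + 1 /\ q = 2 * b + 1).
  by exists a, b; constructor 1.
have [pq'|npq'] := pselect (p' = 2 * c + 1 /\ q' = 2 * d + 1).
  by exists c, d; constructor 2.
case: pE => pE; case: qE => qE; try by case: npq.
- exfalso; move: det; rewrite pE qE; lia.
- case: p'E => p'E; first by exfalso; move: det; rewrite pE p'E; lia.
  case: q'E => q'E; last by case: npq'.
  exists (a + c), (b + d); constructor 3; lia.
- case: q'E => q'E; first by exfalso; move: det; rewrite qE q'E; lia.
  case: p'E => p'E; last by case: npq'.
  exists (a + c), (b + d); constructor 3; lia.
Qed.

(** A reduced p / q is completed to a unimodular pair; then p / q, p' / q' or their mediant has odd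
    numerator and odd denominator m with q <= m <= 3 q. It lies within 1 / (q m) of p / q, so the
    error is at most 2 / q^2 <= 18 / m^2. Starting from q >= 2 n + 1 ensures j >= n. *)
Lemma odd_odd_approx y (n : nat) : irrational y ->
  exists (i : int) (j : nat), (n <= j)%N /\
    `|y - (2 * i + 1)%:~R / (2 * j + 1)%N%:R| <= 18 * (2 * j + 1)%N%:R ^- 2.
Proof.
move=> irr; have [q [p [u [v [q0 qn uv pq]]]]] := reduced_approx (2 * n + 1) irr.
have qR : 0 < q%:R :> R by rewrite ltr0n.
(* Adding a multiple of (p, q) to the Bézout solution keeps the determinant and brings q' between q
   and 2 q. *)
pose t : int := 1 - (u %/ q%:Z)%Z.
pose q' : int := u + t * q; pose p' : int := - v + t * p.
have det : p * q' - p' * q = 1 by rewrite /p' /q' -uv; ring.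
have q'E : q' = (u %% q%:Z)%Z + q.
  by rewrite /q' /t {1}(divz_eq u q); ring.
have q'0 : q%:Z <= q' by rewrite q'E lerDr modz_ge0 // eqz_nat -lt0n.
have q'1 : q' <= 2 * q%:Z.
  have : (u %% q%:Z)%Z < q%:Z by apply: ltz_pmod; rewrite ltz_nat.
  by rewrite q'E; clear; lia.
suff [s [r [qr r3 [i [j [sE rE]]] srq]]] : exists s r : int, [/\ q%:Z <= r, r <= 3 * q%:Z,
    exists i j : int, s = 2 * i + 1 /\ r = 2 * j + 1 & `|s * q - p * r| <= 1].
  have j0 : n%:Z <= j by clear - rE qn qr; lia.
  have jE : j = `|j|%N by rewrite gez0_abs //; clear - j0; lia.
  exists i, `|j|%N; split; first by clear - j0; lia.
  have rN : r = (2 * `|j| + 1)%N by rewrite rE {1}jE; clear; lia.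
  set m := (2 * `|j| + 1)%N in rN *.
  have mR : 0 < m%:R :> R by rewrite ltr0n /m addn1.
  have m3 : m%:R <= 3 * q%:R :> R by rewrite -natrM ler_nat; move: r3; rewrite rN; clear; lia.
  have qm : q%:R <= m%:R :> R by rewrite ler_nat; move: qr; rewrite rN; clear; lia.
  rewrite -sE.
  apply: (@le_trans _ _ (2 * q%:R ^- 2)).
    rewrite mulr2n mulrDl !mul1r; apply: le_trans (ler_distD (p%:~R / q%:R) _ _) _.
    apply: lerD => //.
    rewrite (_ : _ - _ = - ((s * q%:Z - p * r)%:~R / (q%:R * m%:R))); last first.
      by rewrite rN intrB !intrM -!pmulrn; field; rewrite !gt_eqF.
    rewrite normrN normrM normfV (ger0_norm (mulr_ge0 (ltW qR) (ltW mR))) expr2 !invfM.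
    apply: (@le_trans _ _ (1 * (q%:R^-1 * m%:R^-1))).
      rewrite ler_wpM2r ?mulr_ge0 ?invr_ge0 ?ler0n //.
      by rewrite -intr_norm -[1]/(1%:~R) ler_int.
    by rewrite mul1r ler_pM2l ?invr_gt0 // lef_pV2 ?posrE.
  rewrite ler_pdivrMr ?exprn_gt0 // mulrAC ler_pdivlMr ?exprn_gt0 //.
  have : m%:R ^+ 2 <= (3 * q%:R) ^+ 2 :> R by rewrite lerXn2r ?nnegrE ?mulr_ge0 ?ler0n.
  by rewrite exprMn; lra.
have [i [j [[pE qE]|[p'E q''E]|[sE rE]]]] := unimodular_odd_sum det.
- exists p, q%:Z; split; [by [] | by clear; lia | by exists i, j |].
  by rewrite mulrC subrr normr0.
- exists p', q'; split; [by [] | by clear -q'1; lia | by exists i, j |].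
  by rewrite (_ : _ - _ = -1) ?normrN1 // -det; ring.
- exists (p + p'), (q%:Z + q'); split; [by clear -q'0; lia | by clear -q'1; lia | by exists i, j |].
  by rewrite (_ : _ - _ = -1) ?normrN1 // -det; ring.
Qed.
End odd_approximation.

Section order2_fails.
Variable R : realType.
Implicit Types (x y alpha c : R).
Local Notation mu := (@lebesgue_measure R).

Definition odd_badly_approximable c (n : nat) : set R :=
  [set x | forall (i : int) (j : nat), (n <= j)%N ->
     c <= (2 * j + 1)%N%:R ^+ 2 * `|2 * x - (2 * i + 1)%:~R / (2 * j + 1)%N%:R| ].

Lemma closed_odd_badly_approximable c n : closed (odd_badly_approximable c n).
Proof.
pose f (ij : int * nat) x := (2 * ij.2 + 1)%N%:R ^+ 2 *
   `|2 * x - (2 * ij.1 + 1)%:~R / (2 * ij.2 + 1)%N%:R|.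
have -> : odd_badly_approximable c n =
    \bigcap_(ij in [set ij : int * nat | (n <= ij.2)%N]) (f ij @^-1` [set y | c <= y]).
  apply/seteqP; split=> [x bx [i j] /= nj|x bx i j nj]; first exact: bx.
  exact: (bx (i, j)).
apply: closed_bigI => ij _; apply: preimage_closed; last exact: closed_ge.
move=> x _; apply: cvgMr; apply: cvg_norm; apply: cvgB; last exact: cvg_cst.
by apply: cvgMr; exact: cvg_id.
Qed.

(* Near every irrational point the set misses a fixed proportion of an
   arbitrarily small ball, so it has no irrational density points. *)
Lemma odd_badly_approximable_ae c n : 0 < c -> c <= 1 ->
  {ae mu, forall x, irrational x -> ~ odd_badly_approximable c n x}.
Proof.
move=> c0 c1; have mB := closed_measurable (@closed_odd_badly_approximable c n).
apply: (@filterS _ _ (ae_filter_ringOfSetsType mu) _ _ _ (lebesgue_density mB)) => x dens irr Bx; move: dens.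
rewrite indicE mem_set // => /fine_cvgP[_ /cvgrPdist_lt /(_ (c / 20))].
rewrite divr_gt0 // => /(_ isT)[e /= e0 eP].
have irr2 : irrational (2 * x) by apply: (irrational_mul_int (k := 2)).
have [m mP] := exists_nat_gt (10 / e).
have [i [j [nj approx]]] := odd_odd_approx (n + m) irr2.
set q : R := (2 * j + 1)%N%:R in approx *.
have q1 : 1 <= q by rewrite ler1n addn1.
have q0 : 0 < q by lra.
have qm : m%:R <= q by rewrite ler_nat; apply: leq_trans (leq_addl n m) _; clear -nj; lia.
(* The ball of radius [h] around [z] misses the set. As |x - z| <= 9 / q^2 (half of 18) and c / 2 <=
   1, it lies in the ball of radius [rho] around x, of which it occupies the proportion h / rho = c
   / 20. *)
pose z := (2 * i + 1)%:~R / q / 2; pose rho := 10 / q ^+ 2; pose h := c / 2 / q ^+ 2.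
have q20 : 0 < q ^+ 2 by rewrite exprn_gt0.
have rho0 : 0 < rho by rewrite divr_gt0.
have h0 : 0 < h by rewrite !divr_gt0.
have rhoe : rho < e.
  rewrite /rho ltr_pdivrMr // mulrC -ltr_pdivrMr //; apply: lt_le_trans mP _.
  by apply: le_trans qm _; rewrite expr2 ler_peMr // ltW.
have xz : `|x - z| <= 9 / q ^+ 2.
  rewrite (_ : x - z = (2 * x - (2 * i + 1)%:~R / q) / 2); last by rewrite /z; field; rewrite gt_eqF.
  by rewrite normrM [`|2^-1|]ger0_norm // ler_pdivrMr //; apply: le_trans approx _; lra.
have hole : ball z h `<=` ball x rho.
  move=> w; rewrite /ball /= => zw; apply: le_lt_trans (ler_distD z _ _) _.
  apply: (@lt_le_trans _ _ (9 / q ^+ 2 + h)); first by rewrite ler_ltD.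
  rewrite /h /rho -mulrDl ler_pM2r ?invr_gt0 //; lra.
have disj : odd_badly_approximable c n `&` ball z h = set0.
  rewrite -subset0 => w [Bw]; rewrite /ball /= distrC => wz.
  have := Bw i j (leq_trans (leq_addr _ _) nj); rewrite leNgt => /negP; apply.
  rewrite -/q mulrC -ltr_pdivlMr //.
  rewrite (_ : 2 * w - _ = (w - z) * 2); last by rewrite /z; field; rewrite gt_eqF.
  rewrite normrM [`|2|]ger0_norm // -ltr_pdivlMr //; move: wz; rewrite /h.
  by congr (_ < _); field; rewrite gt_eqF.
have mball y r : measurable (ball y r : set R) by exact: measurable_ball.
have := eP rho; rewrite /= sub0r normrN ger0_norm ?(ltW rho0) // => /(_ rhoe rho0).
set M := mu (_ `&` _).
have Mle : (M + (h *+ 2)%:E <= (rho *+ 2)%:E)%E.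
  rewrite -(lebesgue_measure_ball x (ltW rho0)) -(lebesgue_measure_ball z (ltW h0)).
  have mBx := measurableI _ _ mB (mball x rho).
  have mU := measurableU _ _ mBx (mball z h).
  have MU : mu ((odd_badly_approximable c n `&` ball x rho) `|` ball z h) = (M + mu (ball z h))%E.
    by apply: measureU => //; [exact: mball | rewrite setIAC disj set0I].
  rewrite -MU; apply: le_measure; rewrite ?inE //; first exact: mball.
  by rewrite subUset; split=> //; exact: subIsetr.
have M0 : (0 <= M)%E by exact: measure_ge0.
have Mfin : M \is a fin_num.
  rewrite ge0_fin_numE //; apply: le_lt_trans (ltry (rho *+ 2)).
  by apply: le_trans Mle; rewrite leeDl // lee_fin mulrn_wge0 // ltW.
have ME : M = (fine M)%:E by rewrite fineK.
move: Mle; rewrite ME -EFinD lee_fin lebesgue_measure_ball ?(ltW rho0) //.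
rewrite inver mulrn_eq0 /= gt_eqF // -EFinM /= => Mle.
have rho2 : 0 < rho *+ 2 by rewrite mulrn_wgt0.
have hr : h / rho = c / 20 by rewrite /h /rho; field; rewrite gt_eqF.
have : fine M / (rho *+ 2) <= 1 - c / 20.
  rewrite ler_pdivrMr // -hr mulrBl mul1r.
  rewrite (_ : h / rho * (rho *+ 2) = h *+ 2); last by rewrite mulrnAr divfK ?gt_eqF.
  by clear -Mle; lra.
move=> ratio; rewrite ltr_norml => /andP[_]; lra.
Qed.

Lemma odd_approximable_ae : {ae mu, forall x, irrational x ->
  forall c n, 0 < c -> exists (i : int) (j : nat), (n <= j)%N /\
    (2 * j + 1)%N%:R ^+ 2 * `|2 * x - (2 * i + 1)%:~R / (2 * j + 1)%N%:R| < c}.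
Proof.
have ae1 : {ae mu, forall x (k : nat), forall n : nat, irrational x ->
    ~ odd_badly_approximable k.+1%:R^-1 n x}.
  apply/ae_foralln => k; apply/ae_foralln => n; apply: odd_badly_approximable_ae.
    by rewrite invr_gt0.
  by rewrite invf_le1 // ler1n.
apply: (@filterS _ _ (ae_filter_ringOfSetsType mu) _ _ _ ae1) => x H irr c n c0.
have [k kP] := exists_nat_gt c^-1; have := H k n irr; apply: contra_notP => none i j nj.
rewrite leNgt; apply/negP => lt; apply: none; exists i, j; split=> //.
apply: lt_trans lt _; rewrite invf_plt ?posrE //; apply: lt_trans kP _; by rewrite ltr_nat.
Qed.

Lemma sumset2P (A : set nat) n : sumset 2 A n -> exists a b, [/\ A a, A b & n = (a + b)%N].
Proof.
move=> [a [Aa ->]]; exists (a ord0), (a (lift ord0 ord0)); split=> //.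
by rewrite !big_ord_recl big_ord0 addn0.
Qed.

Lemma dist_int_half : dist_int (2^-1 : R) = 2^-1.
Proof.
apply/le_anti/andP; split; first exact: dist_int_le_half.
have [n ->] := dist_int_witness (2^-1 : R).
have [n0|n1] := lerP n 0.
  have nR : n%:~R <= 0 :> R by rewrite lerz0.
  by rewrite ger0_norm; lra.
have nR : 1 <= n%:~R :> R by rewrite -[1]/(1%:~R) ler_int -gtz0_ge1.
by rewrite ler0_norm; lra.
Qed.

(** Doubling gives 2 a^2 alpha + 1, not an integer unless a = 0. This treats the finitely many small
    a, for which [eps a] need not be small. *)
Lemma dist_int_half_gt0 alpha (a : nat) : irrational alpha ->
  0 < dist_int (alpha * a%:R ^+ 2 + 2^-1).
Proof.
move=> irr; case: a => [|a]; first by rewrite expr0n mulr0 add0r dist_int_half.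
have : 0 < dist_int ((2 * a.+1 ^ 2)%:Z%:~R * alpha).
  by apply: dist_int_gt0 => //; rewrite eqz_nat muln_eq0 expn_eq0.
rewrite -(dist_int_addz _ 1).
rewrite (_ : _ + 1%:~R = 2%:R * (alpha * a.+1%:R ^+ 2 + 2^-1)); last first.
  by rewrite -pmulrn natrM natrX; field.
by move=> /lt_le_trans/(_ (dist_int_natM _ _)); rewrite pmulr_rgt0.
Qed.

(* With [2 alpha N] very close to an odd integer and [N] odd,
   [alpha (N - a) ^ 2 - alpha a ^ 2 = alpha N ^ 2 - 2 alpha N a] is close to a half-integer. *)
Lemma not_basis_order2 alpha (eps : nat -> R) : irrational alpha ->
  (forall c n, 0 < c -> exists (i : int) (j : nat), (n <= j)%N /\
    (2 * j + 1)%N%:R ^+ 2 * `|2 * alpha - (2 * i + 1)%:~R / (2 * j + 1)%N%:R| < c) ->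
  eps @ \oo --> (0 : R) -> ~ additive_basis 2 (sq_bohr_set alpha eps).
Proof.
move=> irr approx /cvgrPdist_le eps0 [N1 _ N1P].
have eps_small d : 0 < d -> exists K, forall n, (K <= n)%N -> eps n <= d.
  move=> /eps0[K _ KP]; exists K => n /KP /=; rewrite sub0r normrN; apply: le_trans.
  exact: ler_norm.
(* If both summands are at least [K], then 1/2 <= 1/32 + 1/32 + 1/8, a contradiction. If a < [K],
   then [d] separates alpha a^2 from the half-integers, while b >= [K2] gives [eps b] <= d / 4. *)
have [K KP] := eps_small (1 / 32) ltac:(lra).
have [d [d0 dP]] := @finite_lower_bound R (fun a => dist_int (alpha * a%:R ^+ 2 + 2^-1)) K
  (fun a _ => dist_int_half_gt0 a irr).
have [K2 K2P] := eps_small (d / 4) ltac:(lra).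
pose c := Num.min (1 / 8) (d / 8).
have c0 : 0 < c by rewrite lt_min; lra.
have [c8 cd] : c <= 1 / 8 /\ c <= d / 8 by rewrite !ge_min !lexx orbT.
have [i [j [jn ij]]] := approx c (N1 + K + K + K2)%N c0.
have [jN1 jK jK2] : [/\ N1 <= 2 * j + 1, 2 * K <= 2 * j + 1 & K + K2 <= 2 * j + 1]%N.
  by clear -jn; split; lia.
set N := (2 * j + 1)%N in ij jN1 jK jK2.
have [a [b [Aa Ab NE]]] := sumset2P (N1P N jN1).
wlog ab : a b Aa Ab NE / (a <= b)%N.
  move=> H; have [|/ltnW] := leqP a b; first exact: (H a b).
  by apply: (H b a) => //; rewrite addnC.
have NR : 0 < N%:R :> R by rewrite ltr0n /N addn1.
pose eta := 2 * alpha * N%:R - (2 * i + 1)%:~R.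
have etaN : `|eta| * N%:R < c.
  apply: le_lt_trans ij; rewrite le_eqVlt; apply/orP; left; apply/eqP.
  rewrite -[in X in _ = X](ger0_norm (exprn_ge0 2 (ltW NR))) -normrM -[X in _ * X = _](ger0_norm (ltW NR)).
  by rewrite -normrM /eta; congr `|_|; field; rewrite gt_eqF.
have aR : 0 <= a%:R :> R by [].
have aN : 2 * a%:R <= N%:R :> R by rewrite -natrM ler_nat; clear -NE ab; lia.
have near_half : dist_int (alpha * a%:R ^+ 2 + 2^-1) <= dist_int (alpha * b%:R ^+ 2) + c.
  have bE : b%:R = N%:R - a%:R :> R by rewrite NE natrD addrC addKr.
  (* The half comes from (2 i + 1) (2 j + 1) / 2, half a product of odd numbers; [eta] is the error
     of 2 alpha N against 2 i + 1. *)
  have -> : alpha * a%:R ^+ 2 + 2^-1 = (alpha * b%:R ^+ 2 - eta * (N%:R / 2 - a%:R)) +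
      ((2 * i + 1) * a%:Z - 2 * i * j%:Z - i - j%:Z)%:~R.
    by rewrite bE /eta !(intrD, intrB, intrM) -!pmulrn /N natrD natrM; field.
  rewrite dist_int_addz; apply: le_trans (dist_intB _ _) _; rewrite lerD2l.
  apply: le_trans (dist_int_le_norm _) _; rewrite normrM.
  apply: le_trans (ltW etaN); rewrite ler_wpM2l // ger0_norm; lra.
have [aK|Ka] := ltnP a K.
  have := dP a aK; have := K2P b; move: Ab; rewrite /sq_bohr_set /= => Ab.
  move=> /(_ _)/wrap[]; first by clear -aK NE jK2; lia.
  lra.
move: Aa Ab; rewrite /sq_bohr_set /= => Aa Ab.
have ea := KP a Ka; have eb := KP b (leq_trans Ka ab).
have := dist_intB (alpha * a%:R ^+ 2 + 2^-1) (alpha * a%:R ^+ 2).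
rewrite addrAC subrr add0r dist_int_half; lra.
Qed.

Theorem ae_not_basis_order2 : {ae mu, forall alpha : R, irrational alpha ->
  forall eps : nat -> R, (forall n, 0 < eps n) -> eps @ \oo --> (0 : R) ->
    ~ additive_basis 2 (sq_bohr_set alpha eps)}.
Proof.
apply: (@filterS _ _ (ae_filter_ringOfSetsType mu) _ _ _ odd_approximable_ae) => alpha approx irr eps _.
exact: not_basis_order2 irr (approx irr).
Qed.
End order2_fails.

(** * Numbers with highly divisible convergents *)

Section arithmetic.

(** [b0] is the part of M built from primes not dividing q'. A prime factor of M dividing q' divides
    neither q nor [b0]; any other divides [b0] but not q'. Either way it does not divide q' + b0 q,
    and adding multiples of M to [b0] changes nothing. *)
Lemma coprime_shift (q q' M B : nat) : (0 < M)%N -> (0 < q')%N -> coprime q q' ->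
  exists b, (B <= b)%N /\ coprime (q' + b * q) M.
Proof.
move=> M0 q'0 cop; pose b0 := (M`_(\pi(q')^'))%N.
exists (M * B + b0)%N; split.
  by apply: leq_trans (leq_addr _ _); exact: leq_pmull.
apply: contraT => ncop.
have g0 : (0 < gcdn (q' + (M * B + b0) * q) M)%N by rewrite gcdn_gt0 M0 orbT.
have [pi [pi_pr]] : exists pi, prime pi /\ (pi %| gcdn (q' + (M * B + b0) * q) M)%N.
  exists (pdiv (gcdn (q' + (M * B + b0) * q) M)); rewrite pdiv_dvd pdiv_prime //.
  by rewrite ltn_neqAle g0 eq_sym ncop.
rewrite dvdn_gcd => /andP[pi_sum piM].
have {}pi_sum : (pi %| q' + b0 * q)%N.
  move: pi_sum; rewrite mulnDl addnCA dvdn_addr //.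
  by rewrite -mulnA dvdn_mulr.
have b0E : (pi %| b0)%N = (pi \in (\pi(q')^')%N).
  transitivity (pi \in primes b0); first by rewrite mem_primes pi_pr part_gt0.
  by rewrite primes_part mem_filter mem_primes pi_pr M0 piM /= andbT.
have [piq'|npiq'] := boolP (pi %| q')%N.
  have : (pi %| b0 * q)%N by rewrite -(dvdn_addr _ piq').
  rewrite Euclid_dvdM // b0E inE /= mem_primes pi_pr q'0 piq' /= => piq.
  have : (pi %| gcdn q q')%N by rewrite dvdn_gcd piq.
  by rewrite (eqP cop) dvdn1 => /eqP pi1; move: pi_pr; rewrite pi1.
have : (pi %| b0)%N by rewrite b0E inE /= mem_primes pi_pr q'0.
by move=> pib; move: pi_sum; rewrite dvdn_addl ?dvdn_mulr // (negbTE npiq').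
Qed.

Lemma divisible_shift (q t M B : nat) : (0 < M)%N -> coprime t M ->
  exists b, (B <= b)%N /\ (M %| q + b * t)%N.
Proof.
case: M => // M _ cop; have [t0|t0] := posnP t.
  move: cop; rewrite t0 /coprime gcd0n => /eqP ->.
  by exists B; rewrite dvd1n.
have [[u v] /= uv] := coprimeP _ t0 cop.
have uvE : (u * t = v * M.+1 + 1)%N by lia.
(* Modulo [M.+1], [u] inverts [t] and [M] is -1, so the first term is -q / t; the second makes b
   large. *)
exists (q * M * u + M.+1 * B)%N; split.
  by apply: leq_trans (leq_addl _ _); exact: leq_pmull.
have -> : (q + (q * M * u + M.+1 * B) * t = M.+1 * (q + q * M * v + B * t))%N.
  rewrite mulnDl -[(q * M * u * t)%N]mulnA uvE; lia.
exact: dvdn_mulr.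
Qed.
End arithmetic.

Section lopsided.
Variable R : realType.
Implicit Types (alpha kappa : R).

(* [p n / q n] and [r n / t n] are the convergents of [alpha] from below and from above. *)
Definition divisible_convergents alpha (p q r t : nat -> nat) : Prop :=
  forall n, [/\ [/\ (0 < q n)%N, (n`! %| q n)%N, coprime (p n) (q n) & coprime (t n) (q n.+1)],
    (n.+1 * q n <= t n)%N, (n.+1 * t n <= q n.+1)%N,
    0 < (q n)%:R * alpha - (p n)%:R < (t n)%:R^-1 &
    0 < (r n)%:R - (t n)%:R * alpha < (q n.+1)%:R^-1].

(** The product u v is so small that one factor is at most kappa / 4, and the slack of the other
    absorbs it. Here u and v compare N with two consecutive convergent denominators, whose ratio is
    large. *)
Lemma weighted_sum_le1 (kappa u v : R) : 0 < kappa -> kappa <= 1 / 2 -> 0 <= u -> 0 <= v ->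
  u * (1 - kappa / 2) <= 1 -> v <= 1 - kappa / 2 -> u * v <= kappa ^+ 2 / 16 ->
  (1 - kappa) * u + v <= 1.
Proof.
move=> k0 k1 u0 v0 uk vk uv; have [vle|vgt] := leP v (kappa / 4).
  have h : (1 - kappa) * u <= (1 - kappa / 2) * ((1 - kappa / 2) * u).
    by rewrite mulrA ler_wpM2r //; nra.
  have : (1 - kappa / 2) * ((1 - kappa / 2) * u) <= (1 - kappa / 2) * 1.
    by rewrite ler_pM2l ?(mulrC _ u) //; lra.
  lra.
have ule : u <= kappa / 4.
  have h := ler_wpM2l u0 (ltW vgt).
  have : u * (kappa / 4) <= (kappa / 4) * (kappa / 4) by rewrite expr2 in uv; lra.
  by rewrite ler_pM2r //; lra.
have : (1 - kappa) * u <= 1 * u by rewrite ler_wpM2r //; lra.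
lra.
Qed.

Section convergents.
Variables (alpha : R) (p q r t : nat -> nat).
Hypothesis conv : divisible_convergents alpha p q r t.

Lemma conv_gt0 n : (0 < q n)%N /\ (0 < t n)%N.
Proof.
have [[q0 _ _ _] qt _ _ _] := conv n; split=> //.
by apply: leq_trans qt; rewrite muln_gt0.
Qed.

Lemma conv_q_le m n : (m <= n)%N -> (q m <= q n)%N.
Proof.
elim: n => [|n IH]; first by rewrite leqn0 => /eqP ->.
rewrite leq_eqVlt => /predU1P[-> //|]; rewrite ltnS => /IH mn.
apply: leq_trans mn _; have [_ qt tq _ _] := conv n.
apply: (@leq_trans (t n)); first by apply: leq_trans qt; exact: leq_pmull.
by apply: leq_trans tq; exact: leq_pmull.
Qed.

Lemma conv_q_ge n : (n <= q n)%N.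
Proof.
have [[q0 nq _ _] _ _ _ _] := conv n; apply: leq_trans (dvdn_leq q0 nq).
case: n {q0 nq} => // n; rewrite factS leq_pmulr //; exact: fact_gt0.
Qed.

Lemma conv_dvd n l : (0 < l <= n)%N -> (l %| q n)%N.
Proof.
move=> ln; have [[_ nq _ _] _ _ _ _] := conv n; apply: dvdn_trans nq.
exact: dvdn_fact.
Qed.

(** For alpha = a / b, the number b (q b * alpha - p b) would be an integer strictly between 0 and
    1, because b < t b. *)
Lemma conv_irrational : irrational alpha.
Proof.
move=> /rationalP[a [b abE]].
have [b0|b0] := posnP b.
  have [_ _ _ /andP[h _] _] := conv 0.
  move: h; rewrite abE b0 invr0 !mulr0 sub0r oppr_gt0 => h.
  by have := lt_le_trans h (ler0n R (p 0)); rewrite ltxx.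
have bR : 0 < b%:R :> R by rewrite ltr0n.
have [_ qt _ /andP[h h1] _] := conv b; have [q0 t0] := conv_gt0 b.
have tR : 0 < (t b)%:R :> R by rewrite ltr0n.
pose z : int := (q b)%:Z * a - (p b * b)%N%:Z.
have zE : z%:~R = ((q b)%:R * alpha - (p b)%:R) * b%:R.
  by rewrite /z intrB intrM -!pmulrn natrM abE; field; rewrite gt_eqF.
have : 0 < z%:~R :> R by rewrite zE mulr_gt0.
rewrite ltr0z gtz0_ge1 -(ler_int R) zE leNgt => /negP; apply.
apply: (@lt_trans _ _ ((t b)%:R^-1 * b%:R)); first by rewrite ltr_pM2r.
rewrite mulrC ltr_pdivrMr // mul1r ltr_nat; apply: leq_trans qt.
exact: leq_pmulr.
Qed.

(** Since 2 l divides q n, the integer N p n - m (q n / l) is an odd number minus an even one, hence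
    nonzero; its absolute value is bounded by the right-hand side. *)
Lemma conv_approx_divisible n (N l : nat) (m : int) : (2 * l <= n)%N -> (0 < l)%N ->
  odd N -> odd `|m|%N -> 
  1 <= (q n)%:R * `|alpha * N%:R - m%:~R / l%:R| + N%:R / (t n)%:R.
Proof.
move=> ln l0 oN om; have [q0 t0] := conv_gt0 n.
have [[_ _ cpq _] _ _ /andP[d0 d1] _] := conv n.
have /dvdnP[k qE] : (2 * l %| q n)%N by apply: conv_dvd; rewrite muln_gt0 l0.
have op : odd (p n).
  have q2 : (2 %| q n)%N by apply: dvdn_trans (dvdn_mulr l (dvdnn 2)) _; rewrite qE dvdn_mull.
  by move: (coprime_dvdr q2 cpq); rewrite coprimen2.
have lR : 0 < l%:R :> R by rewrite ltr0n.
pose z : int := N%:Z * (p n)%:Z - m * (2 * k)%N%:Z.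
have z1 : (1 <= `|z|)%R.
  rewrite -gtz0_ge1 normr_gt0 subr_eq0; apply/eqP => /(congr1 absz).
  rewrite !abszM !absz_nat => /(congr1 odd); rewrite !oddM oN op om; lia.
have zE : z%:~R = (q n)%:R * (alpha * N%:R - m%:~R / l%:R) - N%:R * ((q n)%:R * alpha - (p n)%:R).
  rewrite /z intrB !intrM -!pmulrn qE !natrM; field; by rewrite gt_eqF.
have : 1 <= `|z%:~R| :> R by rewrite -intr_norm -[1]/(1%:~R) ler_int.
rewrite zE => /le_trans; apply; apply: le_trans (ler_normB _ _) _; rewrite !normrM.
rewrite [`|(q n)%:R|]ger0_norm // [`|N%:R|]ger0_norm // lerD2l ler_wpM2l //.
by rewrite ger0_norm ltW.
Qed.

(** Being coprime to the even q n.+1, t n is odd, so l N r n - m t n is an even number minus an odd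
    one and cannot vanish. *)
Lemma conv_approx_coprime n (N l : nat) (m : int) : (1 <= n)%N -> (0 < l)%N ->
  ~~ odd l -> odd `|m|%N ->
  1 <= l%:R * ((t n)%:R * `|alpha * N%:R - m%:~R / l%:R| + N%:R / (q n.+1)%:R).
Proof.
move=> n1 l0 el om.
have [[_ _ _ ctq] _ _ _ /andP[d0 d1]] := conv n.
have ot : odd (t n).
  have q2 : (2 %| q n.+1)%N by apply: conv_dvd.
  by move: (coprime_dvdr q2 ctq); rewrite coprimen2.
have lR : 0 < l%:R :> R by rewrite ltr0n.
pose z : int := (l * N * r n)%N%:Z - m * (t n)%:Z.
have z1 : (1 <= `|z|)%R.
  rewrite -gtz0_ge1 normr_gt0 subr_eq0; apply/eqP => /(congr1 absz).
  rewrite abszM !absz_nat => /(congr1 odd); rewrite !oddM ot om (negbTE el); lia.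
have zE : z%:~R = l%:R * ((t n)%:R * (alpha * N%:R - m%:~R / l%:R) + N%:R * ((r n)%:R - (t n)%:R * alpha)).
  rewrite /z intrB !intrM -!pmulrn !natrM; field; by rewrite gt_eqF.
have : 1 <= `|z%:~R| :> R by rewrite -intr_norm -[1]/(1%:~R) ler_int.
rewrite zE => /le_trans; apply; rewrite normrM [`|l%:R|]ger0_norm // ler_wpM2l //.
apply: le_trans (ler_normD _ _) _; rewrite !normrM.
rewrite [`|(t n)%:R|]ger0_norm // [`|N%:R|]ger0_norm // lerD2l ler_wpM2l //.
by rewrite ger0_norm ltW.
Qed.

(** Take n least with l N < c q n.+1, where c is slightly below 1, so that also c q n <= l N. A
    smaller distance would contradict one of the two preceding lemmas through [weighted_sum_le1];
    large partial quotients make u v small enough. *)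
Lemma conv_no_even (L : nat) kappa : 0 < kappa -> kappa <= 1 / 2 ->
  exists N0 : nat, forall (N l : nat) (m : int), (N0 <= N)%N -> odd N ->
    (0 < l <= L)%N -> ~~ odd l -> odd `|m|%N ->
    (1 - kappa) / (l%:R * N%:R) <= `|alpha * N%:R - m%:~R / l%:R|.
Proof.
move=> k0 k1; have [A AP] := exists_nat_gt (16 * L%:R / kappa ^+ 2).
pose n0 := (2 * L + A + 1)%N; exists (q n0) => N l m N0 oN /andP[l0 lL] el om.
pose c : R := 1 - kappa / 2; have c0 : 0 < c by rewrite /c; lra.
have Npos : (0 < N)%N by case: N oN {N0}.
have NR : 0 < N%:R :> R by rewrite ltr0n.
have lR : 0 < l%:R :> R by rewrite ltr0n.
have ex : exists n, l%:R * N%:R < c * (q n.+1)%:R.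
  have [n nP] := exists_nat_gt (l%:R * N%:R / c); exists n.
  rewrite [ltRHS]mulrC -ltr_pdivrMr //; apply: lt_le_trans nP _.
  by rewrite ler_nat; apply: leq_trans (conv_q_ge _); exact: leqnSn.
have [n /= nP nmin] := ex_minnP ex.
have n0n : (n0 <= n)%N.
  rewrite leqNgt; apply/negP => nn0; move: nP; apply/negP; rewrite -leNgt.
  apply: (@le_trans _ _ (1 * (q n0)%:R)).
    by apply: ler_pM => //; [exact: ltW | rewrite /c; lra | rewrite ler_nat conv_q_le].
  by apply: ler_pM => //; rewrite ?ler1n // ler_nat.
have n1 : (1 <= n)%N by apply: leq_trans n0n; rewrite /n0 addn1.
have nlow : c * (q n)%:R <= l%:R * N%:R.
  rewrite leNgt; apply/negP => h; have := nmin n.-1; rewrite prednK // => /(_ h).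
  by rewrite leqNgt ltn_predL n1.
have ln : (2 * l <= n)%N.
  by apply: leq_trans n0n; rewrite /n0; clear -lL; lia.
have [q0 t0] := conv_gt0 n; have [q1 _] := conv_gt0 n.+1.
have [_ qt tq _ _] := conv n.
have qR : 0 < (q n)%:R :> R by rewrite ltr0n.
have tR : 0 < (t n)%:R :> R by rewrite ltr0n.
have qR1 : 0 < (q n.+1)%:R :> R by rewrite ltr0n.
have nA : 16 * L%:R <= kappa ^+ 2 * n.+1%:R.
  rewrite [leRHS]mulrC -ler_pdivrMr ?exprn_gt0 //; apply: le_trans (ltW AP) _.
  rewrite ler_nat; apply: leq_trans (leqnSn n); apply: leq_trans n0n; rewrite /n0; clear; lia.
have L1 : 1 <= L%:R :> R by rewrite ler1n (leq_trans l0).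
have lLR : l%:R <= L%:R :> R by rewrite ler_nat.
have l1R : 1 <= l%:R :> R by rewrite ler1n.
have qtR : n.+1%:R * (q n)%:R <= (t n)%:R :> R by rewrite -natrM ler_nat.
have tqR : n.+1%:R * (t n)%:R <= (q n.+1)%:R :> R by rewrite -natrM ler_nat.
rewrite leNgt; apply/negP; set D := `|_|; rewrite ltr_pdivlMr ?mulr_gt0 // => small.
have D0 : 0 <= D by exact: normr_ge0.
(* Below c t n the lower convergent p n / q n gives the contradiction, above it the upper convergent
   r n / t n. *)
have [Nt|tN] := leP N%:R (c * (t n)%:R).
  have := conv_approx_divisible ln l0 oN om; rewrite -/D leNgt => /negP; apply.
  pose u : R := (q n)%:R / (l%:R * N%:R); pose v : R := N%:R / (t n)%:R.
  have : (1 - kappa) * u + v <= 1.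
    apply: weighted_sum_le1 => //; rewrite ?divr_ge0 ?mulr_ge0 //.
    - by rewrite /u mulrAC ler_pdivrMr ?mulr_gt0 // mul1r mulrC.
    - by rewrite /v ler_pdivrMr.
    - rewrite (_ : u * v = (q n)%:R / (l%:R * (t n)%:R)); last first.
        by rewrite /u /v; field; rewrite !gt_eqF.
      rewrite ler_pdivrMr ?mulr_gt0 //.
      have h1 : kappa ^+ 2 * (n.+1%:R * (q n)%:R) <= kappa ^+ 2 * (t n)%:R by rewrite ler_wpM2l ?sqr_ge0.
      have h2 : 16 * L%:R * (q n)%:R <= kappa ^+ 2 * n.+1%:R * (q n)%:R by rewrite ler_wpM2r // ltW.
      have h3 : 1 * (q n)%:R <= L%:R * (q n)%:R :> R by rewrite ler_wpM2r // ltW.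
      have h4 : 1 * (kappa ^+ 2 * (t n)%:R) <= l%:R * (kappa ^+ 2 * (t n)%:R).
        by rewrite ler_wpM2r // mulr_ge0 ?sqr_ge0 // ltW.
      rewrite mulrA in h1; clear -h1 h2 h3 h4; lra.
  apply: lt_le_trans; rewrite ltrD2r /u mulrA ltr_pdivlMr ?mulr_gt0 //.
  rewrite (_ : _ * D * _ = (q n)%:R * (D * (l%:R * N%:R))); last ring.
  by rewrite [ltRHS]mulrC ltr_pM2l.
have := conv_approx_coprime N n1 l0 el om; rewrite -/D leNgt => /negP; apply.
pose u : R := (t n)%:R / N%:R; pose v : R := l%:R * N%:R / (q n.+1)%:R.
have : (1 - kappa) * u + v <= 1.
  apply: weighted_sum_le1 => //; rewrite ?divr_ge0 ?mulr_ge0 //.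
  - by rewrite /u mulrAC ler_pdivrMr // mul1r mulrC ltW.
  - by rewrite /v ler_pdivrMr // ltW.
  - rewrite (_ : u * v = l%:R * (t n)%:R / (q n.+1)%:R); last first.
      by rewrite /u /v; field; rewrite !gt_eqF.
    rewrite ler_pdivrMr //.
    have h1 : kappa ^+ 2 * (n.+1%:R * (t n)%:R) <= kappa ^+ 2 * (q n.+1)%:R by rewrite ler_wpM2l ?sqr_ge0.
    have h2 : 16 * L%:R * (t n)%:R <= kappa ^+ 2 * n.+1%:R * (t n)%:R by rewrite ler_wpM2r // ltW.
    have h3 : l%:R * (t n)%:R <= L%:R * (t n)%:R :> R by rewrite ler_wpM2r // ltW.
    rewrite mulrA in h1; clear -h1 h2 h3; lra.
apply: lt_le_trans; rewrite mulrDr mulrA (mulrA l%:R N%:R) ltrD2r /u mulrA ltr_pdivlMr //.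
rewrite (_ : _ * D * _ = (t n)%:R * (D * (l%:R * N%:R))); last ring.
by rewrite [ltRHS]mulrC ltr_pM2l.
Qed.
End convergents.
End lopsided.

(** * Construction by nested Farey intervals *)

Section farey.
Variable R : realType.

(* [p / q < r / t] are Farey neighbours. *)
Definition farey_pair (s : (nat * nat) * (nat * nat)) : Prop :=
  let: ((p, q), (r, t)) := s in [/\ (0 < q)%N, (0 < t)%N & (r * q = p * t + 1)%N].

(** The upper endpoint moves first, so the first equation makes p / q and r' / t' neighbours. The
    final disjunction leaves x outside the new open interval. *)
Definition farey_refine (n : nat) (x : R) (s s' : (nat * nat) * (nat * nat)) : Prop :=
  let: ((p, q), (r, t)) := s in let: ((p', q'), (r', t')) := s' in
  [/\ (r' * q = p * t' + 1)%N, (n.+1 * q <= t')%N, (n.+1 * t' <= q')%N, (n.+1`! %| q')%N &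
     [/\ (p * q' < p' * q)%N, (r' * t < r * t')%N &
        q'%:R * x <= p'%:R \/ r'%:R <= t'%:R * x]].

(** The upper endpoint becomes (r + b p) / (t + b q) with t' coprime to the factorial, so that the
    lower one can become (p + c r') / (q + c t') with q' divisible by it. *)
Lemma farey_refine_exists n x s : farey_pair s -> exists s', farey_pair s' /\ farey_refine n x s s'.
Proof.
case: s => [[p q] [r t]] /= [q0 t0 det]; have qR : 0 < q%:R :> R by rewrite ltr0n.
have cop : coprime q t.
  have : (gcdn q t %| 1)%N.
    rewrite -(dvdn_addr 1 (_ : gcdn q t %| p * t)%N) ?dvdn_mull ?dvdn_gcdr //.
    by rewrite -det dvdn_mull ?dvdn_gcdl.
  by rewrite dvdn1.
have [A AP] := exists_nat_gt (x * q%:R - p%:R)^-1.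
have [b [bA cop']] := coprime_shift (n.+2 + A) (fact_gt0 n.+1) t0 cop.
set t' := (t + b * q)%N in cop'.
have t'0 : (0 < t')%N by rewrite addn_gt0 t0.
have [c [cA div']] := divisible_shift q n.+1 (fact_gt0 n.+1) cop'.
pose r' := (r + b * p)%N; pose q' := (q + c * t')%N; pose p' := (p + c * r')%N.
have det1 : (r' * q = p * t' + 1)%N by rewrite /r' /t' !mulnDl det; lia.
have det2 : (r' * q' = p' * t' + 1)%N by rewrite /q' /p' mulnDr mulnDl det1; lia.
exists ((p', q'), (r', t')); split=> /=.
  by split=> //; rewrite addn_gt0 q0.
have ctq : (n.+1 * t' <= q')%N.
  by apply: leq_trans (leq_addl _ _); rewrite leq_mul2r cA orbT.
split=> //.
  apply: leq_trans (leq_addl _ _); rewrite leq_mul2r; apply/orP; right.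
  by apply: leq_trans bA; rewrite addSn ltnS (leq_trans _ (leq_addr _ _)) .
split.
- rewrite -(ltn_add2r c) /q' /p' mulnDl mulnDr -mulnA det1; have := leq_trans (ltn0Sn n) cA; lia.
- rewrite /r' /t' mulnDl mulnDr -mulnA.
  have -> : (r * (b * q) = b * (p * t) + b)%N by rewrite mulnCA det; lia.
  have : (0 < b)%N by apply: leq_trans bA.
  by clear; lia.
(* If x <= p / q, the increased lower endpoint excludes x. Otherwise r' / t' = p / q + 1 / (q t')
   has dropped to x or below, as t' exceeds 1 / (x q - p). *)
have [xp|px] := leP (x * q%:R) p%:R; [left|right].
  rewrite -(ler_pM2r qR) mulrAC [_ * x]mulrC.
  rewrite mulrCA [leLHS]mulrC; apply: (@le_trans _ _ (p%:R * q'%:R)).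
    by rewrite ler_wpM2r.
  rewrite -!natrM ler_nat /q' /p' mulnDl mulnDr -mulnA det1; lia.
rewrite -(ler_pM2r qR) -natrM det1 natrD natrM.
have h : 1 <= t'%:R * (x * q%:R - p%:R).
  have px' : 0 < x * q%:R - p%:R by rewrite subr_gt0.
  rewrite -ler_pdivrMr // mul1r; apply: le_trans (ltW AP) _; rewrite ler_nat.
  apply: leq_trans (leq_addl _ _); apply: (@leq_trans b).
    by apply: leq_trans bA; exact: leq_addl.
  exact: leq_pmulr.
by rewrite mulrBr in h; lra.
Qed.

Lemma divisible_convergents_avoiding (f : nat -> R) :
  exists alpha p q r t, divisible_convergents alpha p q r t /\ forall n, alpha <> f n.
Proof.
have /choice[F FP] (ns : nat * ((nat * nat) * (nat * nat))) : exists s',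
    farey_pair ns.2 -> farey_pair s' /\ farey_refine ns.1 (f ns.1) ns.2 s'.
  have [/(farey_refine_exists ns.1 (f ns.1))[s' s'P]|no] := pselect (farey_pair ns.2).
    by exists s'.
  by exists ns.2.
pose S := fix S n := if n is m.+1 then F (m, S m) else ((0, 1), (1, 1))%N.
have Spair n : farey_pair (S n).
  by elim: n => [|n IH] //=; have [] := FP (n, S n) IH.
have Sstep n : farey_refine n (f n) (S n) (S n.+1) by have [] := FP (n, S n) (Spair n).
pose p n := (S n).1.1; pose q n := (S n).1.2; pose r n := (S n).2.1; pose t n := (S n).2.2.
have pairP n : [/\ (0 < q n)%N, (0 < t n)%N & (r n * q n = p n * t n + 1)%N].
  by have := Spair n; rewrite /p /q /r /t /farey_pair; case: (S n) => [[? ?] [? ?]].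
have stepP n : [/\ (r n.+1 * q n = p n * t n.+1 + 1)%N, (n.+1 * q n <= t n.+1)%N,
    (n.+1 * t n.+1 <= q n.+1)%N, (n.+1`! %| q n.+1)%N &
    [/\ (p n * q n.+1 < p n.+1 * q n)%N, (r n.+1 * t n < r n * t n.+1)%N &
       (q n.+1)%:R * f n <= (p n.+1)%:R \/ (r n.+1)%:R <= (t n.+1)%:R * f n]].
  have := Sstep n; rewrite /p /q /r /t /farey_refine.
  by case: (S n) (S n.+1) => [[? ?] [? ?]] [[? ?] [? ?]].
have qR n : 0 < (q n)%:R :> R by rewrite ltr0n; have [] := pairP n.
have tR n : 0 < (t n)%:R :> R by rewrite ltr0n; have [] := pairP n.
pose lo n : R := (p n)%:R / (q n)%:R; pose hi n : R := (r n)%:R / (t n)%:R.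
have lo_lt n : lo n < lo n.+1.
  have [_ _ _ _ [h _ _]] := stepP n.
  by rewrite /lo ltr_pdivrMr // mulrAC ltr_pdivlMr // -!natrM ltr_nat.
have hi_lt n : hi n.+1 < hi n.
  have [_ _ _ _ [_ h _]] := stepP n.
  by rewrite /hi ltr_pdivrMr // mulrAC ltr_pdivlMr // -!natrM ltr_nat.
have lohi n : lo n < hi n.
  have [_ _ h] := pairP n.
  by rewrite /lo /hi ltr_pdivrMr // mulrAC ltr_pdivlMr // -!natrM ltr_nat h addn1.
have lo_le m n : (m <= n)%N -> lo m <= lo n.
  move=> mn; rewrite -(subnKC mn); elim: (n - m)%N => [|k IH]; first by rewrite addn0.
  by rewrite addnS; apply: le_trans IH (ltW _).
have hi_le m n : (m <= n)%N -> hi n <= hi m.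
  move=> mn; rewrite -(subnKC mn); elim: (n - m)%N => [|k IH]; first by rewrite addn0.
  by rewrite addnS; apply: le_trans IH; apply: ltW.
have lo_le_hi m n : lo m <= hi n.
  apply: le_trans (lo_le _ _ (leq_maxl m n)) _; apply: le_trans (ltW (lohi _)) _.
  exact/hi_le/leq_maxr.
pose alpha := sup (range lo).
have hs : has_sup (range lo).
  by split; [exists (lo 0), 0%N | exists (hi 0) => _ [n _ <-]].
have lo_alpha n : lo n < alpha.
  apply: lt_le_trans (lo_lt n) _; apply: ub_le_sup; first by case: hs.
  by exists n.+1.
have alpha_hi n : alpha < hi n.
  apply: le_lt_trans (hi_lt n); apply: ge_sup; first by case: hs.
  by move=> _ [m _ <-].
(* The shift by one reflects the order of refinement: t n.+1 is built after q n and before q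
   n.+1. *)
exists alpha, p, q, (fun n => r n.+1), (fun n => t n.+1); split=> n; last first.
  have [_ _ _ _ [_ _ [h|h]]] := stepP n => alphaE.
    have := lo_alpha n.+1; rewrite /lo ltr_pdivrMr // alphaE mulrC ltNge h //.
  by have := alpha_hi n.+1; rewrite /hi ltr_pdivlMr // alphaE mulrC ltNge h.
have [det1 qt tq div _] := stepP n; have [q0 t0 det] := pairP n.
have [q1 t1 det'] := pairP n.+1.
have cop a b c d : (a * b = c * d + 1)%N -> coprime c b /\ coprime d b.
  move=> abcd; have H e : (e %| b)%N -> (e %| c * d)%N -> (e %| 1)%N.
    by move=> eb ecd; rewrite -(dvdn_addr 1 ecd) -abcd dvdn_mull.
  split; rewrite /coprime -dvdn1; apply: H; rewrite ?dvdn_gcdr //.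
    by rewrite dvdn_mulr ?dvdn_gcdl.
  by rewrite dvdn_mull ?dvdn_gcdl.
have [cpq _] := cop _ _ _ _ det; have [_ ctq] := cop _ _ _ _ det'.
split=> //.
- by split=> //; case: n {det1 qt tq div q0 t0 det q1 t1 det' cpq ctq} => [|n] //; have [] := stepP n.
- have := lo_alpha n; have := alpha_hi n.+1; rewrite /lo /hi ltr_pdivlMr // ltr_pdivrMr // => h1 h2.
  rewrite subr_gt0 mulrC h2 /= -(ltr_pM2l (tR n.+1)) divff ?gt_eqF //.
  have : (r n.+1)%:R * (q n)%:R = (p n)%:R * (t n.+1)%:R + 1 :> R by rewrite -natrM det1 natrD natrM.
  have := qR n; rewrite -(ltr_pM2r (qR n)) in h1; move: h1; clear; lra.
- have := lo_alpha n.+1; have := alpha_hi n.+1; rewrite /lo /hi ltr_pdivlMr // ltr_pdivrMr // => h1 h2.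
  rewrite subr_gt0 mulrC h1 /= -(ltr_pM2l (qR n.+1)) divff ?gt_eqF //.
  have : (r n.+1)%:R * (q n.+1)%:R = (p n.+1)%:R * (t n.+1)%:R + 1 :> R by rewrite -natrM det' natrD natrM.
  rewrite -(ltr_pM2r (tR n.+1)) in h2; move: h2; clear; lra.
Qed.
End farey.

(** * Resonant integers *)

Section resonant_arithmetic.

Lemma coprimez_residue (m sigma : int) (l : nat) : (0 < l)%N -> coprimez m l ->
  exists (s : nat) (k : int), (s < l)%N /\ m * s%:Z = sigma + k * l%:Z.
Proof.
move=> l0 /eqP cop; have [u [v uv]] := Bezoutz m l; rewrite cop in uv.
have lz : l%:Z != 0 by rewrite eqz_nat -lt0n.
have s0 : 0 <= (sigma * u %% l)%Z by exact: modz_ge0.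
have sl : (sigma * u %% l)%Z < l by apply: ltz_pmod; rewrite ltz_nat.
have sE := divz_eq (sigma * u) l.
exists `|(sigma * u %% l)%Z|%N, (- sigma * v - m * (sigma * u %/ l)%Z); split.
  by rewrite -ltz_nat gez0_abs.
rewrite gez0_abs // (_ : (_ %% _)%Z = sigma * u - (sigma * u %/ l)%Z * l); last by rewrite [X in X - _]sE addrC addKr.
have -> : m * (sigma * u - (sigma * u %/ l)%Z * l) =
  sigma * (u * m + v * l) - sigma * v * l - m * (sigma * u %/ l)%Z * l by ring.
by rewrite uv; ring.
Qed.

Lemma half_progression_start (N s : nat) : odd N = odd s ->
  (2 * (N + s)./2 = N + s)%N.
Proof. by move=> Ns; rewrite mul2n even_halfK // oddD Ns addbb. Qed.

Lemma odd_residue (m sigma k : int) (l s : nat) : ~~ odd l -> odd `|sigma| ->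
  m * s%:Z = sigma + k * l%:Z -> odd s.
Proof.
move=> el os E; apply: contraLR os => es; have -> : sigma = m * s%:Z - k * l%:Z by rewrite E addrK.
rewrite -(even_halfK es) -(even_halfK el) -!muln2 !PoszM !mulrA -mulrBl.
by rewrite abszM oddM andbF.
Qed.
End resonant_arithmetic.

Section resonant.
Variable R : realType.
Implicit Types (alpha delta kappa C : R).

(** Because alpha (N - a)^2 = alpha a^2 - alpha N (2 a - N), it suffices to make alpha a^2 small
    along the progression. In u this is a quadratic with coefficient l^2 alpha, and bounded l gives
    one threshold. *)
Lemma progression_order2 alpha delta (L : nat) : irrational alpha -> 0 < delta ->
  exists U0 : nat, forall U N l a0 : nat, (U0 <= U)%N -> (0 < l <= L)%N ->
    (forall u, (u < U)%N -> (a0 + l * u <= N)%N /\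
       dist_int (alpha * N%:R * (2 * (a0 + l * u)%N%:R - N%:R)) <= delta / 2) ->
    sumset 2 (sq_bohr_set alpha (fun=> delta)) N.
Proof.
move=> irr d0; have d2 : 0 < delta / 2 by rewrite divr_gt0.
have [U0 U0P] : exists w, forall l, (l < L.+1)%N -> forall W, (w <= W)%N -> (0 < l)%N ->
    forall mu nu, exists2 a, (a < W)%N &
      dist_int ((l ^ 2)%N%:R * alpha * a%:R ^+ 2 + mu * a%:R + nu) < delta / 2.
  apply: finite_eventually => -[|l] _; first by exists 0%N.
  have [] := quadratic_dist_int (alpha := (l.+1 ^ 2)%N%:R * alpha) _ d2.
    by apply: (irrational_mul_int (k := (l.+1 ^ 2)%N)).
  by move=> w wP; exists w => W wW _ mu nu; exact: wP.
exists U0 => U N l a0 U0U /andP[l0 lL] window.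
have [u uU du] := U0P l lL U U0U l0 (2 * alpha * a0%:R * l%:R) (alpha * a0%:R ^+ 2).
have [aN da] := window u uU; set a := (a0 + l * u)%N in aN da.
have {}du : dist_int (alpha * a%:R ^+ 2) < delta / 2.
  by move: du; congr (dist_int _ < _); rewrite /a natrD natrM natrX; ring.
rewrite -(subnKC aN); apply: sumset2; rewrite /sq_bohr_set /=; first lra.
rewrite natrB // (_ : alpha * _ = alpha * a%:R ^+ 2 - alpha * N%:R * (2 * a%:R - N%:R)); last ring.
by apply: le_trans (dist_intB _ _) _; lra.
Qed.

Lemma resonance_reduced alpha C (N l : nat) : (0 < N)%N -> (0 < l)%N ->
  N%:R * dist_int ((- 2 * l%:R) * alpha * N%:R) < C ->
  exists (m : int) (k : nat), [/\ (0 < k <= 2 * l)%N, coprimez m k &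
    N%:R * `|alpha * N%:R - m%:~R / k%:R| < C].
Proof.
move=> N0 l0; have [n ->] := dist_int_witness ((- 2 * l%:R) * alpha * N%:R) => h.
have gd : gcdz (- n) (2 * l)%N = (gcdn `|n| (2 * l))%:Z by rewrite /gcdz abszN.
have g0 : (0 < gcdn `|n| (2 * l))%N by rewrite gcdn_gt0 muln_gt0 l0 orbT.
set g := gcdn _ _ in gd g0.
have [m mE] : exists m : int, - n = m * g%:Z by apply/dvdzP; rewrite -gd dvdz_gcdl.
have [k kE] : exists k : nat, (2 * l = k * g)%N by apply/dvdnP; exact: dvdn_gcdr.
have /andP[k0 _] : (0 < k)%N && (0 < g)%N by rewrite -muln_gt0 -kE muln_gt0 l0.
have kR : 0 < k%:R :> R by rewrite ltr0n.
exists m, k; split.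
- by rewrite k0 kE leq_pmulr.
- have gz : g%:Z != 0 by rewrite eqz_nat -lt0n.
  apply/eqP; apply: (mulIf gz); rewrite mul1r -[in RHS]gd mE kE PoszM.
  by rewrite -mulz_gcdl.
apply: le_lt_trans h; rewrite ler_wpM2l //.
have nE : n%:~R = - (m%:~R * g%:R) :> R by rewrite -[n]opprK mE intrN intrM -pmulrn.
have lE : 2 * l%:R = k%:R * g%:R :> R by rewrite -!natrM kE.
have -> : - 2 * l%:R * alpha * N%:R - n%:~R = - (k%:R * g%:R * (alpha * N%:R - m%:~R / k%:R)).
  by rewrite !mulNr lE nE; field; rewrite gt_eqF.
rewrite normrN normrM ler_peMl // ger0_norm ?mulr_ge0 //.
by rewrite -natrM ler1n muln_gt0 k0.
Qed.

(** With 2 a - N = l w, the main term m (2 a - N) / l is an integer. The choice w = 2 u + (N mod 2)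
    gives l w the parity of N, since l is odd whenever N is. *)
Lemma resonant_compatible_order2 alpha delta C (L : nat) : irrational alpha ->
  0 < delta -> 0 < C ->
  exists N0 : nat, forall (N l : nat) (m : int), (N0 <= N)%N -> (0 < l <= L)%N ->
    odd N ==> odd l -> N%:R * `|alpha * N%:R - m%:~R / l%:R| < C ->
    sumset 2 (sq_bohr_set alpha (fun=> delta)) N.
Proof.
move=> irr d0 C0; have [U0 U0P] := progression_order2 L irr d0.
have [A AP] := exists_nat_gt (8 * L%:R * C / delta).
(* As w <= 2 N / K, the part 8 L ensures l w <= N, and [A] makes the error l w D < 2 L C / K at most
   delta / 4. *)
pose K := (A + 8 * L + 1)%N; have K0 : (0 < K)%N by rewrite /K addn1.
have KR : 0 < K%:R :> R by rewrite ltr0n.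
exists (K * U0)%N => N l m NK lL Nl res; have /andP[l0 lL'] := lL.
have lR : 0 < l%:R :> R by rewrite ltr0n.
have lLR : l%:R <= L%:R :> R by rewrite ler_nat.
set D := `|_| in res; have D0 : 0 <= D by exact: normr_ge0.
have N2 : odd N = odd (odd N * l)%N by case: (odd N) Nl => //=; rewrite mul1n => ->.
have a0E := half_progression_start N2.
apply: (U0P (N %/ K)%N N l ((N + odd N * l)./2)%N _ lL); first by rewrite leq_divRL // mulnC.
move=> u uU; set w := (2 * u + odd N)%N.
have aE : (2 * ((N + odd N * l)./2 + l * u) = N + l * w)%N.
  by rewrite mulnDr a0E /w; clear; lia.
have wK : (w * K <= 2 * N)%N.
  have wU : (w <= 2 * (N %/ K))%N by rewrite /w; case: (odd N); clear -uU; lia.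
  apply: (@leq_trans (2 * (N %/ K) * K)); first by rewrite leq_mul2r wU orbT.
  by rewrite -mulnA leq_mul2l /= leq_trunc_div.
have lwN : (l * w <= N)%N.
  have h1 : (l * w * K <= 2 * N * L)%N by rewrite -mulnA mulnC leq_mul.
  have h2 : (2 * N * L <= N * K)%N.
    rewrite -mulnA mulnCA leq_mul2l; apply/orP; right; rewrite /K; clear; lia.
  by rewrite -(leq_pmul2r K0) (leq_trans h1).
split; first by rewrite -(leq_pmul2l (isT : 0 < 2)%N) aE; clear -lwN; lia.
rewrite -natrM aE natrD addrAC subrr add0r natrM.
have -> : alpha * N%:R * (l%:R * w%:R) =
   l%:R * w%:R * (alpha * N%:R - m%:~R / l%:R) + (m * w%:Z)%:~R.
  by rewrite intrM -pmulrn; field; rewrite gt_eqF.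
rewrite dist_int_addz; apply: le_trans (dist_int_le_norm _) _.
rewrite normrM -/D ger0_norm ?mulr_ge0 //.
have wKR : w%:R * K%:R <= 2 * N%:R :> R by rewrite -!natrM ler_nat.
rewrite -(ler_pM2r KR).
have h1 : l%:R * D * (w%:R * K%:R) <= l%:R * D * (2 * N%:R).
  by rewrite ler_wpM2l // mulr_ge0 // ltW.
have h2 : 2 * l%:R * (N%:R * D) <= 2 * l%:R * C.
  by rewrite ler_wpM2l ?mulr_ge0 // ltW.
have h3 : 2 * l%:R * C <= 2 * L%:R * C by rewrite ler_wpM2r ?(ltW C0) // ler_pM2l.
have h4 : 8 * L%:R * C <= delta * K%:R.
  rewrite [leRHS]mulrC -ler_pdivrMr //; apply: le_trans (ltW AP) _.
  by rewrite ler_nat /K -addnA leq_addr.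
have h5 : 0 <= L%:R * C by rewrite mulr_ge0 // ltW.
clear -h1 h2 h3 h4 h5; lra.
Qed.

(* Here [alpha N - m / l = +- D] with [l] even and [N] odd.  As [2 a - N = s] is odd,
   the best option is [m s = -+ 1] modulo [l], with [D s] close to [1 / l];
   the lower bound on [D] is exactly what makes [s <= N] possible. *)
Lemma resonant_even_order2 alpha delta kappa C (L : nat) : irrational alpha ->
  0 < delta -> 0 < C -> 0 < kappa -> kappa <= 1 / 2 -> kappa <= delta / 4 ->
  exists N0 : nat, forall (N l : nat) (m : int), (N0 <= N)%N -> (0 < l <= L)%N ->
    odd N -> ~~ odd l -> coprimez m l ->
    (1 - kappa) / (l%:R * N%:R) <= `|alpha * N%:R - m%:~R / l%:R| ->
    N%:R * `|alpha * N%:R - m%:~R / l%:R| < C ->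
    sumset 2 (sq_bohr_set alpha (fun=> delta)) N.
Proof.
move=> irr d0 C0 k0 k1 kd; have [U0 U0P] := progression_order2 L irr d0.
have [A AP] := exists_nat_gt (4 * L%:R ^+ 2 * C / kappa).
have [B BP] := exists_nat_gt (6 * L%:R ^+ 2 * C / kappa).
pose K := (A + 1)%N; have K0 : (0 < K)%N by rewrite /K addn1.
have KR : 0 < K%:R :> R by rewrite ltr0n.
exists (K * U0 + B + 1)%N => N l m NK lL oN el cop lowD res; have /andP[l0 lL'] := lL.
have lR : 0 < l%:R :> R by rewrite ltr0n.
have l1 : 1 <= l%:R :> R by rewrite ler1n.
have lLR : l%:R <= L%:R :> R by rewrite ler_nat.
have LR : 0 < L%:R :> R by apply: lt_le_trans lLR.
have N0 : (0 < N)%N by apply: leq_trans NK; rewrite addn1.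
have NR : 0 < N%:R :> R by rewrite ltr0n.
set X := alpha * N%:R - m%:~R / l%:R in lowD res.
have [sigma [os [sX sE]]] : exists sigma : int, odd `|sigma|%N /\
    (X = sigma%:~R * `|X| /\ `|sigma%:~R| = 1 :> R).
  have [X0|X0] := leP 0 X.
    by exists 1; rewrite mulr1z mul1r normr1 ger0_norm.
  by exists (-1); rewrite intrN mulr1z mulN1r normrN1 ltr0_norm // opprK.
set D := `|X| in lowD res sX.
have D0 : 0 < D.
  by apply: lt_le_trans lowD; rewrite divr_gt0 ?mulr_gt0 //; lra.
(* [S] is the value of s with D s = 1 / l. The s used below lie between (1 - 2 kappa) S and (1 -
   kappa) S, and the latter is at most N. *)
pose S := (D * l%:R)^-1; have DlS : D * l%:R * S = 1 by rewrite /S divff // gt_eqF ?mulr_gt0.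
have S0 : 0 < S by rewrite invr_gt0 mulr_gt0.
have SN : (1 - kappa) * S <= N%:R.
  have : 1 - kappa <= D * l%:R * N%:R by rewrite -mulrA -ler_pdivrMr ?mulr_gt0.
  move=> /(ler_wpM2r (ltW S0)) /le_trans; apply.
  by rewrite mulrAC DlS mul1r.
have NS : N%:R <= C * l%:R * S.
  have -> : N%:R = N%:R * D * (l%:R * S) by rewrite -!mulrA (mulrA D) DlS mulr1.
  by rewrite -[leRHS]mulrA ler_wpM2r ?mulr_ge0 ?(ltW S0) ?(ltW res) // ltW.
have [s0 [k [s0l s0E]]] := coprimez_residue (- sigma) l0 cop.
have os0 : odd s0.
  by apply: (odd_residue el _ s0E); rewrite abszN.
pose x := (1 - 2 * kappa) * S / (2 * l%:R).
have x0 : 0 <= x by rewrite divr_ge0 ?mulr_ge0 ?(ltW S0) ?(ltW lR) //; lra.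
have /andP[xlo xhi] := truncn_itv x0.
pose u0 := (Num.truncn x).+1.
have u0lo : (1 - 2 * kappa) * S <= 2 * l%:R * u0%:R.
  by rewrite [leRHS]mulrC -ler_pdivrMr ?mulr_gt0 // ltW.
have u0hi : 2 * l%:R * u0%:R <= (1 - 2 * kappa) * S + 2 * l%:R.
  have : (Num.truncn x)%:R * (2 * l%:R) <= (1 - 2 * kappa) * S.
    by rewrite -ler_pdivlMr ?mulr_gt0.
  rewrite /u0 -[_.+1%:R]natr1; clear; lra.
have hB : 6 * L%:R ^+ 2 * C <= kappa * N%:R.
  rewrite [leRHS]mulrC -ler_pdivrMr //; apply: le_trans (ltW BP) _.
  by rewrite ler_nat; apply: leq_trans NK; rewrite -addnA addnCA leq_addr.
have hA : 4 * L%:R ^+ 2 * C <= kappa * K%:R.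
  rewrite [leRHS]mulrC -ler_pdivrMr //; apply: le_trans (ltW AP) _.
  by rewrite ler_nat leq_addr.
pose U := (N %/ K)%N.
have UK : U%:R * K%:R <= N%:R :> R by rewrite -natrM ler_nat leq_trunc_div.
(* Since S >= N / (C l), the interval of length kappa S holds the residue s0 < l, the overshoot 2 l
   of [u0] and U further steps of 2 l. *)
have wide : 3 * l%:R + 2 * l%:R * U%:R <= kappa * S.
  have CL0 : 0 < C * L%:R by rewrite mulr_gt0.
  have U0' : 0 <= U%:R :> R by [].
  have h0 : kappa * N%:R <= kappa * (C * L%:R * S).
    rewrite ler_pM2l //; apply: le_trans NS _.
    by rewrite ler_pM2r // ler_pM2l.
  have h1 : 4 * L%:R ^+ 2 * C * U%:R <= kappa * N%:R.
    apply: le_trans (ler_wpM2r U0' hA) _.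
    by rewrite -mulrA ler_pM2l // mulrC.
  have h2 : C * L%:R * (3 * L%:R + 2 * L%:R * U%:R) <= C * L%:R * (kappa * S).
    rewrite (_ : C * L%:R * (kappa * S) = kappa * (C * L%:R * S)); last ring.
    apply: le_trans h0.
    rewrite (_ : C * L%:R * _ = (6 * L%:R ^+ 2 * C + 4 * L%:R ^+ 2 * C * U%:R) / 2); last by field.
    by clear -hB h1; lra.
  rewrite ler_pM2l // in h2; apply: le_trans h2; apply: lerD.
    by rewrite ler_pM2l.
  by rewrite ler_wpM2r // ler_pM2l.
have a0E := half_progression_start (etrans oN (esym os0) : odd N = odd s0).
apply: (U0P U N l ((N + s0)./2 + l * u0)%N _ lL).
  by rewrite leq_divRL // mulnC; apply: leq_trans NK; rewrite -addnA leq_addr.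
move=> u uU; pose s := (s0 + 2 * l * (u0 + u))%N.
have aE : (2 * ((N + s0)./2 + l * u0 + l * u) = N + s)%N.
  by rewrite !mulnDr a0E /s; clear; lia.
have sR : s%:R = s0%:R + 2 * l%:R * u0%:R + 2 * l%:R * u%:R :> R.
  by rewrite /s natrD !natrM natrD; ring.
have slo : (1 - 2 * kappa) * S <= s%:R.
  have : 0 <= s0%:R :> R by []. have : 0 <= l%:R * u%:R :> R by [].
  by rewrite sR; move: u0lo; clear; lra.
have shi : s%:R <= (1 - kappa) * S.
  have : s0%:R <= l%:R :> R by rewrite ler_nat ltnW.
  have : l%:R * u%:R <= l%:R * U%:R :> R by rewrite ler_pM2l // ler_nat ltnW.
  by rewrite sR; move: u0hi wide; clear; lra.
have sN : (s <= N)%N by rewrite -(ler_nat R) (le_trans shi).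
split; first by rewrite -(leq_pmul2l (isT : 0 < 2)%N) aE; clear -sN; lia.
rewrite -natrM aE natrD addrAC subrr add0r.
pose j : int := k + m * (2 * (u0 + u))%N%:Z.
have ms : m%:~R * s%:R = - sigma%:~R + j%:~R * l%:R :> R.
  have : m * s%:Z = - sigma + j * l%:Z.
    by rewrite /j /s PoszD !PoszM mulrDr s0E; ring.
  by move=> /(congr1 (fun z : int => z%:~R : R)); rewrite intrD !intrM intrN -!pmulrn.
have aNE : alpha * N%:R = m%:~R / l%:R + sigma%:~R * D by rewrite -sX /X; ring.
(* Since m s is -sigma modulo l, the fractional part of m s / l nearly cancels sigma D s; what
   remains is at most 2 kappa / l <= delta / 2. *)
have -> : alpha * N%:R * s%:R = sigma%:~R * (D * s%:R - l%:R^-1) + j%:~R.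
  rewrite aNE mulrDl mulrAC ms; field; by rewrite gt_eqF.
rewrite dist_int_addz; apply: le_trans (dist_int_le_norm _) _.
rewrite normrM sE mul1r.
have DS : D * S = l%:R^-1 by rewrite /S; field; rewrite !gt_eqF.
have h1 := ler_wpM2l (ltW D0) slo; have h2 := ler_wpM2l (ltW D0) shi.
rewrite mulrCA DS in h1; rewrite mulrCA DS in h2.
have il0 : 0 < l%:R^-1 :> R by rewrite invr_gt0.
have il1 : kappa * l%:R^-1 <= kappa by rewrite ger_pMr // invf_le1.
have ki : 0 < kappa * l%:R^-1 by rewrite mulr_gt0.
rewrite ler_norml; apply/andP; split; move: h1 h2 il0 il1 ki kd; clear; lra.
Qed.

Theorem divisible_convergents_order2 alpha p q r t delta :
  divisible_convergents alpha p q r t -> 0 < delta ->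
  exists N0 : nat, forall N, (N0 <= N)%N -> sumset 2 (sq_bohr_set alpha (fun=> delta)) N.
Proof.
move=> conv d0; have irr := conv_irrational conv.
have [L [C [W0 [C0 main]]]] := nonresonant_order2 irr d0.
pose kappa := Num.min (1 / 2) (delta / 4).
have k0 : 0 < kappa by rewrite lt_min; lra.
have [k1 kd] : kappa <= 1 / 2 /\ kappa <= delta / 4 by rewrite !ge_min !lexx orbT.
have [N1 N1P] := resonant_compatible_order2 (2 * L) irr d0 C0.
have [N2 N2P] := resonant_even_order2 (2 * L) irr d0 C0 k0 k1 kd.
have [N3 N3P] := conv_no_even conv (2 * L) k0 k1.
exists (maxn (maxn W0 N1) (maxn N2 N3)).+1 => N NN.
have N0 : (0 < N)%N by apply: leq_ltn_trans NN.
move: NN; rewrite -[(_ < N)%N]/(_ < N)%N !gtn_max.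
move=> /andP[/andP[/ltnW NW0 /ltnW NN1] /andP[/ltnW NN2 /ltnW NN3]].
have [nonres|] := pselect (forall l, (0 < l <= L)%N ->
    C <= N%:R * dist_int ((- 2 * l%:R) * alpha * N%:R)); first exact: main.
move=> /existsNP[l /not_implyP[/andP[l0 lL] /negP]]; rewrite -ltNge => res.
have [m [k [/andP[k0' kl] cop {}res]]] := resonance_reduced N0 l0 res.
have kL : (0 < k <= 2 * L)%N by rewrite k0' (leq_trans kl) // leq_mul2l.
have [compat|] := boolP (odd N ==> odd k); first exact: (N1P N k m).
rewrite negb_imply => /andP[oN ek].
have om : odd `|m|%N.
  apply: contraT => em; have : (2 %| gcdn `|m| k)%N by rewrite dvdn_gcd !dvdn2 em.
  by move: cop; rewrite /coprimez /gcdz /= => /eqP[->].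
by apply: (N2P N k m) => //; exact: N3P.
Qed.

Theorem uncountable_basis_order2 : ~ countable [set alpha : R | irrational alpha /\
  exists eps_a : nat -> R,
    [/\ forall n, 0 < eps_a n, eps_a @ \oo --> (0 : R) &
        forall eps : nat -> R, (forall n, 0 < eps n) ->
          (forall n, eps_a n <= eps n) -> additive_basis 2 (sq_bohr_set alpha eps)]].
Proof.
set A := [set alpha : R | _] => /countable_injP[g ginj].
(* [f] inverts the injection [g] on A (with default 0), so a number of A avoiding all values of [f]
   is a contradiction. *)
pose f n := xget 0 [set x | A x /\ g x = n].
have [alpha [p [q [r [t [conv avoid]]]]]] := divisible_convergents_avoiding f.
have Aalpha : A alpha.
  split; first exact: conv_irrational conv.
  by apply: uniform_basis => delta; exact: divisible_convergents_order2 conv.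
apply: (avoid (g alpha)); rewrite /f; case: xgetP => [x _ [Ax gx]|/(_ alpha)[]//].
by apply: ginj; rewrite ?inE.
Qed.
End resonant.

Theorem theoremA (R : realType) :
  (* A1 *)
  (forall alpha : R, irrational alpha ->
     exists eps_a : nat -> R,
       [/\ forall n, 0 < eps_a n,
           eps_a @ \oo --> (0 : R) &
           forall eps : nat -> R, (forall n, 0 < eps n) ->
             (forall n, eps_a n <= eps n) ->
             almost_additive_basis R 2 (sq_bohr_set alpha eps)]) /\
  (* A2 *)
  (~ countable [set alpha : R | irrational alpha /\
     exists eps_a : nat -> R,
       [/\ forall n, 0 < eps_a n,
           eps_a @ \oo --> (0 : R) &
           forall eps : nat -> R, (forall n, 0 < eps n) ->
             (forall n, eps_a n <= eps n) ->
             additive_basis 2 (sq_bohr_set alpha eps)]]) /\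
  (* A3 *)
  (forall alpha : R, irrational alpha ->
     exists eps_a : nat -> R,
       [/\ forall n, 0 < eps_a n,
           eps_a @ \oo --> (0 : R) &
           forall eps : nat -> R, (forall n, 0 < eps n) ->
             (forall n, eps_a n <= eps n) ->
             additive_basis 3 (sq_bohr_set alpha eps)]) /\
  (* A4 *)
  {ae (@lebesgue_measure R), forall alpha : R, irrational alpha ->
     forall eps : nat -> R, (forall n, 0 < eps n) ->
       eps @ \oo --> (0 : R) ->
       ~ additive_basis 2 (sq_bohr_set alpha eps)}.
Proof.
split=> [alpha irr|].
  by apply: uniform_almost_basis => delta; exact: almost_basis_order2.
split; first exact: uncountable_basis_order2.
split=> [alpha irr|]; last exact: ae_not_basis_order2.
by apply: uniform_basis => delta; exact: basis_order3.
Qed.
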